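(* Let $\gamma_1,\gamma_2:\mathbb{R}^+\to(0,\frac{\pi}{2})$ be decreasing functions. Let $\mathbf{F}=\{F_t\}_{t\ge0}\subset\mathrm{Hol}(\Pi)$ be a semigroup generated by $f\in\mathrm{Hol}(\Pi,\mathbb{C})$ which satisfies $$-\gamma_1(\mathrm{Re}\,z)\le\arg f(z)\le\gamma_2(\mathrm{Re}\,z)\quad\text{for all } z\in\Pi.$$ Then for each $k>0$, the semigroup $\mathbf{F}^k=\{\Phi_t\}_{t\ge0}$ defined by $\Phi_t(z)=F_t(z+k)-k$ can be analytically extended in $t$ to the sector $\Omega\left(\frac{\pi}{2}-\gamma_1(k),\frac{\pi}{2}-\gamma_2(k)\right)$. In particular, if $\lim_{s\to\infty}\gamma_1(s)=\lim_{s\to\infty}\gamma_2(s)=0$, then for each $\varepsilon>0$ there exists $k>0$ such that $\mathbf{F}^k$ has an analytic extension to the sector $\Omega\left(\frac{\pi}{2}-\varepsilon,\frac{\pi}{2}-\varepsilon\right)$.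
   Context: $\Pi=\{z\in\mathbb{C}:\mathrm{Re}\,z>0\}$, $\mathbb{R}^+=[0,\infty)$. $\mathrm{Hol}(D,U)$ is the set of holomorphic functions on $D$ with values in $U$, and $\mathrm{Hol}(D):=\mathrm{Hol}(D,D)$. A (one-parameter continuous) semigroup on $\Pi$ is a family $\{F_t\}_{t\ge0}\subset\mathrm{Hol}(\Pi)$ with $F_t\circ F_s=F_{t+s}$ for all $t,s\ge0$ and $\lim_{t\to0^+}F_t(z)=z$ for all $z\in\Pi$. Its generator is $f(z)=\lim_{t\to0^+}\frac{F_t(z)-z}{t}$. $\Omega(\theta_1,\theta_2)=\{\zeta:-\theta_1<\arg\zeta<\theta_2\}$. A semigroup $\{\Phi_t\}_{t\ge0}$ on $\Pi$ can be analytically extended to the sector $\Omega=\Omega(\theta_1,\theta_2)$ if there is a family $\{\Phi_\zeta\}_{\zeta\in\Omega}\subset\mathrm{Hol}(\Pi)$, coinciding with $\Phi_t$ for $\zeta=t>0$, analytic in $\zeta$ for each $z\in\Pi$, and satisfying $\Phi_{\zeta_1}\circ\Phi_{\zeta_2}=\Phi_{\zeta_1+\zeta_2}$ for $\zeta_1,\zeta_2\in\Omega$. *)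

(* Defs.v *)
From Stdlib Require Import Reals Lra.
From Coquelicot Require Import Coquelicot.

Open Scope R_scope.

(* Principal argument, with values in (-PI, PI], and the convention Arg 0 = 0
   (an explicit case: the acos formula would give PI / 2 there). *)
Definition Arg (z : C) : R :=
  if Req_EM_T (Cmod z) 0 then 0
  else if Rle_dec 0 (Im z) then acos (Re z / Cmod z)
  else - acos (Re z / Cmod z).

Lemma Arg_0 : Arg (RtoC 0) = 0.
Proof.
  unfold Arg; destruct (Req_EM_T (Cmod (RtoC 0)) 0) as [_ | H].
  - reflexivity.
  - destruct H; apply Cmod_0.
Qed.

Lemma Re_div_Cmod_bound (z : C) :
  Cmod z <> 0 -> -1 <= Re z / Cmod z <= 1.
Proof.
  intros Hz.
  assert (Hp : 0 < Cmod z) by (pose proof (Cmod_ge_0 z); lra).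
  pose proof (Rle_trans _ _ _ (Rmax_l _ _) (Rmax_Cmod z)) as H.
  apply Rabs_le_between in H.
  change (fst z) with (Re z) in H.
  split.
  - apply Rle_div_r; lra.
  - apply Rle_div_l; lra.
Qed.

Lemma Arg_bound (z : C) : - PI < Arg z <= PI.
Proof.
  pose proof PI_RGT_0 as HPI.
  unfold Arg; destruct (Req_EM_T (Cmod z) 0) as [_ | Hz]; [lra |].
  pose proof (acos_bound (Re z / Cmod z)) as Hb.
  destruct (Rle_dec 0 (Im z)) as [_ | Hi]; [lra |].
  split; [| lra].
  destruct (Req_dec (acos (Re z / Cmod z)) PI) as [E | E]; [exfalso | lra].
  apply Hi.
  assert (Hc : Re z / Cmod z = -1).
  { rewrite <- (cos_acos _ (Re_div_Cmod_bound z Hz)), E; apply cos_PI. }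
  assert (HR : Re z = - Cmod z).
  { apply (Rmult_eq_compat_r (Cmod z)) in Hc.
    unfold Rdiv in Hc; rewrite Rmult_assoc, Rinv_l in Hc by exact Hz; lra. }
  assert (HI : Im z * Im z = 0).
  { pose proof (pow2_sqrt ((fst z)^2 + (snd z)^2)) as S.
    change (sqrt (fst z ^ 2 + snd z ^ 2)) with (Cmod z) in S.
    change (fst z) with (Re z) in S; change (snd z) with (Im z) in S.
    assert (0 <= Re z ^ 2 + Im z ^ 2) as P by nra.
    specialize (S P); rewrite HR in S; nra. }
  apply Rmult_integral in HI; lra.
Qed.

Lemma Arg_polar (z : C) :
  z = (Cmod z * cos (Arg z), Cmod z * sin (Arg z)).
Proof.
  unfold Arg; destruct (Req_EM_T (Cmod z) 0) as [H0 | Hz].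
  { rewrite H0, (Cmod_eq_0 z H0); unfold RtoC; f_equal; ring. }
  assert (Hp : 0 < Cmod z) by (pose proof (Cmod_ge_0 z); lra).
  pose proof (Re_div_Cmod_bound z Hz) as Hb.
  assert (HR : Cmod z * (Re z / Cmod z) = Re z) by (field; exact Hz).
  assert (HI : Cmod z * sqrt (1 - (Re z / Cmod z)²) = Rabs (Im z)).
  { rewrite <- (sqrt_Rsqr (Cmod z)) at 1 by lra.
    rewrite <- sqrt_mult_alt by apply Rle_0_sqr.
    rewrite <- sqrt_Rsqr_abs; f_equal.
    assert (S : (Cmod z)² = Re z * Re z + Im z * Im z).
    { unfold Cmod; rewrite Rsqr_sqrt by nra; unfold Re, Im; ring. }
    assert (S' : (Cmod z)² * (Re z / Cmod z)² = Re z * Re z)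
      by (unfold Rsqr; field; exact Hz).
    rewrite Rmult_minus_distr_l, S', Rmult_1_r, S; unfold Rsqr; ring. }
  destruct (Rle_dec 0 (Im z)) as [Hi | Hi].
  - rewrite cos_acos, sin_acos, HR, HI by exact Hb.
    rewrite Rabs_pos_eq by exact Hi. apply surjective_pairing.
  - rewrite cos_neg, sin_neg, cos_acos, sin_acos, HR by exact Hb.
    rewrite Ropp_mult_distr_r_reverse, HI, Rabs_left by lra.
    rewrite Ropp_involutive. apply surjective_pairing.
Qed.

Definition half_plane (z : C) : Prop := 0 < Re z.

(* 0 has no argument, so it is excluded from the sector explicitly. *)
Definition sector (theta1 theta2 : R) (zeta : C) : Prop :=
  zeta <> RtoC 0 /\ - theta1 < Arg zeta < theta2.

(* Differentiability is over the field C, i.e. complex differentiability; it is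
   only used for D open, where it is holomorphy. *)
Definition holomorphic_on (D : C -> Prop) (g : C -> C) : Prop :=
  forall z : C, D z -> @ex_derive C_AbsRing C_NormedModule g z.

Definition Hol (D U : C -> Prop) (g : C -> C) : Prop :=
  (forall z : C, D z -> U (g z)) /\ holomorphic_on D g.

Definition is_semigroup (F : R -> C -> C) : Prop :=
  (forall t : R, 0 <= t -> Hol half_plane half_plane (F t)) /\
  (forall t s : R, 0 <= t -> 0 <= s ->
     forall z : C, half_plane z -> F t (F s z) = F (t + s) z) /\
  (forall z : C, half_plane z ->
     filterlim (fun t : R => F t z) (at_right 0) (locally z)).

Definition is_generator (F : R -> C -> C) (f : C -> C) : Prop :=
  forall z : C, half_plane z ->
    filterlim (fun t : R => ((F t z - z) / RtoC t)%C)
      (at_right 0) (locally (f z)).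

Definition shifted (F : R -> C -> C) (k : R) (t : R) (z : C) : C :=
  (F t (z + RtoC k) - RtoC k)%C.

Definition extends_analytically (Phi : R -> C -> C) (Omega : C -> Prop) : Prop :=
  exists Psi : C -> C -> C,
    (forall zeta : C, Omega zeta -> Hol half_plane half_plane (Psi zeta)) /\
    (forall t : R, 0 < t ->
       forall z : C, half_plane z -> Psi (RtoC t) z = Phi t z) /\
    (forall z : C, half_plane z ->
       holomorphic_on Omega (fun zeta : C => Psi zeta z)) /\
    (forall zeta1 zeta2 : C, Omega zeta1 -> Omega zeta2 ->
       forall z : C, half_plane z ->
         Psi zeta1 (Psi zeta2 z) = Psi (zeta1 + zeta2)%C z).

(* Main.v *)
Require Import Defs.
From Stdlib Require Import Reals Lra Psatz Lia Classical ClassicalEpsilon.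
From Coquelicot Require Import Coquelicot.
Open Scope R_scope.

(** Suppose first that f has no zero; the bound on its argument then gives
    Re f > 0. Let h be a primitive of 1/f on the half-plane. Since Re h' > 0,
    h is injective with a differentiable inverse, and along the semigroup
    h grows at unit speed: h (F_t z) = h z + t (the Abel equation,
    [abel_equation]). Hence F_t = h^-1 (h + t), and the extension to complex
    times zeta must be z |-> h^-1 (h (z + k) + zeta) - k. The semigroup law
    follows from injectivity, and holomorphy in z and in zeta from the
    derivative of h^-1. What has to be proved is that h (z + k) + zeta is a
    value of h at a point of {Re > k}.

    On {Re > k} monotonicity keeps arg f between - gamma1 k and gamma2 k, so
    for zeta in the sector g := zeta f has positive real part there. The
    trajectory of w' = g w, that is, h w = h (z + k) + s zeta, therefore moves
    to the right, away from the boundary. It is defined up to s = 1 because it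
    does not blow up: once {Re > k} is translated to {Re > 0}, the Schwarz-Pick
    inequality |g' w| Re w <= Re (g w) says that |g w| / Re w, the speed of the
    trajectory in the hyperbolic metric, does not increase along it. This is [flow_exists].

    Primitives come from Goursat's theorem, proved on rectangles by bisection
    ([primitive_exists]). The Schwarz-Pick inequality comes from
    Caratheodory's bound |G' 0| <= 2 Re (G 0) on the disc, transported by the
    Cayley map; the bound is the positivity of a mean over a circle, and the
    mean is evaluated with a primitive, after the substitution u = exp (- w)
    which unrolls the punctured disc into the half-plane
    ([Re_limit_nonneg]). Integrated along segments, Schwarz-Pick gives a
    Harnack inequality and an equicontinuity estimate for holomorphic
    self-maps. The latter makes t |-> F_t z continuous from the left, which
    the Abel equation needs because only right limits and right derivatives
    in t are given. The former settles the remaining case: if f vanishes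
    somewhere, then Re f, hence f, is identically 0 and every F_t is the
    identity. *)

(** * Complex and real differentiation *)

(** The derivative of [g] with respect to [j]. With [j] the identity of C it
    is the complex derivative, with [j] the embedding of the reals (or of the
    nonnegative reals) the velocity of a curve, so that sums, products and the
    chain rule are proved once for all of these. *)
Definition deriv_along {X : Type} (j g : X -> C) (x : X) (d : C) : Prop :=
  forall eps : R, 0 < eps -> exists delta : R, 0 < delta /\
    forall y : X, Cmod (j y - j x) < delta ->
      Cmod (g y - g x - d * (j y - j x)) <= eps * Cmod (j y - j x).

Definition cderiv (g : C -> C) (z d : C) : Prop :=
  deriv_along (fun w : C => w) g z d.

Definition rderiv (g : R -> C) (t : R) (v : C) : Prop :=
  deriv_along RtoC g t v.

Definition differentiable_at (g : C -> C) (z : C) : Prop := exists d, cderiv g z d.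

Definition holomorphic (g : C -> C) : Prop :=
  forall z, half_plane z -> differentiable_at g z.

Lemma Cmod_Ci : Cmod Ci = 1.
Proof.
  transitivity (sqrt 1); [| apply sqrt_1].
  unfold Cmod, Ci; simpl; f_equal; ring.
Qed.

Lemma Cmod_re_im (z : C) : Cmod z <= Rabs (Re z) + Rabs (Im z).
Proof.
  replace z with (RtoC (Re z) + Ci * RtoC (Im z))%C at 1
    by (destruct z; unfold Ci, RtoC, Cplus, Cmult, Re, Im; simpl; f_equal; ring).
  eapply Rle_trans; [apply Cmod_triangle |].
  rewrite Cmod_mult, !Cmod_R, Cmod_Ci; lra.
Qed.

Lemma im_le_Cmod (z : C) : Rabs (Im z) <= Cmod z.
Proof. exact (Rle_trans _ _ _ (Rmax_r _ _) (Rmax_Cmod z)). Qed.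

Lemma Cmod_sq (z : C) : Cmod z ^ 2 = Re z ^ 2 + Im z ^ 2.
Proof.
  unfold Cmod. rewrite pow2_sqrt; [reflexivity |].
  apply Rplus_le_le_0_compat; apply pow2_ge_0.
Qed.

Lemma Re_Cconj_mult_self (z : C) : Re (Cconj z * z) = Cmod z ^ 2.
Proof. rewrite Cmod_sq; unfold Re, Im; simpl; ring. Qed.

Lemma Cmod_Cconj (z : C) : Cmod (Cconj z) = Cmod z.
Proof. unfold Cmod; simpl; f_equal; ring. Qed.

Lemma Cmod_sub_comm (z w : C) : Cmod (z - w) = Cmod (w - z).
Proof. rewrite <- Cmod_opp; f_equal; ring. Qed.

Lemma Cmod_triangle_sub (x y z : C) : Cmod (x - z) <= Cmod (x - y) + Cmod (y - z).
Proof.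
  replace (x - z)%C with ((x - y) + (y - z))%C by ring. apply Cmod_triangle.
Qed.

Lemma neq_0_of_Cmod_pos (u : C) : 0 < Cmod u -> u <> 0.
Proof. intros H ->; rewrite Cmod_0 in H; lra. Qed.

Lemma neq_0_of_Re_pos (z : C) : 0 < Re z -> z <> 0.
Proof. intros H ->; simpl in H; lra. Qed.

Lemma eq_of_Cmod_sub_le (z w : C) : (forall eps, 0 < eps -> Cmod (z - w) <= eps) -> z = w.
Proof.
  intros H.
  assert (E : (z - w)%C = 0).
  { apply Cmod_eq_0, Rle_antisym; [| apply Cmod_ge_0].
    apply le_epsilon; intros eps He; rewrite Rplus_0_l; auto. }
  replace z with ((z - w) + w)%C by ring. rewrite E; ring.
Qed.

Lemma cderiv_iff_is_derive (g : C -> C) (z d : C) :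
  cderiv g z d <-> @is_derive C_AbsRing C_NormedModule g z d.
Proof.
  split.
  - intros H; split; [apply is_linear_scal_l |].
    intros x Hx.
    assert (Ex : z = x) by
      (apply (is_filter_lim_locally_unique (V := AbsRing_NormedModule C_AbsRing) z x Hx)).
    subst x.
    intros eps.
    destruct (H eps (cond_pos eps)) as [dl [Hd Hw]].
    exists (mkposreal dl Hd); intros y Hy.
    specialize (Hw y Hy).
    change (Cmod (g y - g z - (y - z) * d) <= eps * Cmod (y - z)).
    rewrite (Cmult_comm (y - z)); exact Hw.
  - intros [_ H] eps Heps.
    specialize (H z (fun P HP => HP) (mkposreal eps Heps)).
    destruct H as [dl Hd].
    exists dl; split; [apply cond_pos |].
    intros y Hy. specialize (Hd y Hy).
    change (Cmod (g y - g z - (y - z) * d) <= eps * Cmod (y - z)) in Hd.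
    rewrite (Cmult_comm (y - z)) in Hd; exact Hd.
Qed.

Section Along.
Context {X : Type} (j : X -> C).

Lemma deriv_along_const (c : C) (x : X) : deriv_along j (fun _ => c) x 0.
Proof.
  intros eps He; exists 1; split; [lra |]; intros y _.
  replace (c - c - 0 * (j y - j x))%C with (RtoC 0) by ring.
  rewrite Cmod_0; apply Rmult_le_pos; [lra | apply Cmod_ge_0].
Qed.

Lemma deriv_along_id (x : X) : deriv_along j j x 1.
Proof.
  intros eps He; exists 1; split; [lra |]; intros y _.
  replace (j y - j x - 1 * (j y - j x))%C with (RtoC 0) by ring.
  rewrite Cmod_0; apply Rmult_le_pos; [lra | apply Cmod_ge_0].
Qed.

Lemma deriv_along_plus (g k : X -> C) (x : X) (d e : C) :
  deriv_along j g x d -> deriv_along j k x e ->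
  deriv_along j (fun y => g y + k y)%C x (d + e).
Proof.
  intros Hg Hk eps He.
  destruct (Hg (eps / 2)) as [d1 [Hd1 H1]]; [lra |].
  destruct (Hk (eps / 2)) as [d2 [Hd2 H2]]; [lra |].
  exists (Rmin d1 d2); split; [apply Rmin_pos; lra |]; intros y Hy.
  specialize (H1 y (Rlt_le_trans _ _ _ Hy (Rmin_l _ _))).
  specialize (H2 y (Rlt_le_trans _ _ _ Hy (Rmin_r _ _))).
  replace (g y + k y - (g x + k x) - (d + e) * (j y - j x))%C
    with ((g y - g x - d * (j y - j x)) + (k y - k x - e * (j y - j x)))%C by ring.
  eapply Rle_trans; [apply Cmod_triangle | lra].
Qed.

Lemma deriv_along_lipschitz (g : X -> C) (x : X) (d : C) :
  deriv_along j g x d -> exists delta M : R, 0 < delta /\ 0 < M /\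
    forall y : X, Cmod (j y - j x) < delta ->
      Cmod (g y - g x) <= M * Cmod (j y - j x).
Proof.
  intros Hg; destruct (Hg 1) as [dl [Hd H]]; [lra |].
  exists dl, (1 + Cmod d); split; [exact Hd |]; split;
    [pose proof (Cmod_ge_0 d); lra |].
  intros y Hy; specialize (H y Hy).
  replace (g y - g x)%C
    with ((g y - g x - d * (j y - j x)) + d * (j y - j x))%C by ring.
  eapply Rle_trans; [apply Cmod_triangle |]. rewrite Cmod_mult; lra.
Qed.

Lemma deriv_along_continuous (g : X -> C) (x : X) (d : C) :
  deriv_along j g x d -> forall eps : R, 0 < eps ->
  exists delta : R, 0 < delta /\ forall y : X, Cmod (j y - j x) < delta ->
    Cmod (g y - g x) < eps.
Proof.
  intros Hg eps He.
  destruct (deriv_along_lipschitz g x d Hg) as [dl [M [Hd [HM H]]]].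
  exists (Rmin dl (eps / M)); split;
    [apply Rmin_pos; [lra | apply Rdiv_lt_0_compat; lra] |].
  intros y Hy.
  apply (Rle_lt_trans _ _ _ (H y (Rlt_le_trans _ _ _ Hy (Rmin_l _ _)))).
  pose proof (Rlt_le_trans _ _ _ Hy (Rmin_r _ _)) as Hy2.
  apply (Rmult_lt_compat_l M) in Hy2; [| lra].
  replace (M * (eps / M)) with eps in Hy2 by (field; lra); lra.
Qed.

Lemma deriv_along_comp (g : X -> C) (k : C -> C) (x : X) (d e : C) :
  deriv_along j g x d -> cderiv k (g x) e ->
  deriv_along j (fun y => k (g y)) x (e * d).
Proof.
  intros Hg Hk eps He.
  destruct (deriv_along_lipschitz g x d Hg) as [d0 [M [Hd0 [HM H0]]]].
  destruct (Hk (eps / 2 / M)) as [d1 [Hd1 H1]];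
    [apply Rdiv_lt_0_compat; lra |].
  assert (Hp : 0 < Cmod e + 1) by (pose proof (Cmod_ge_0 e); lra).
  destruct (Hg (eps / 2 / (Cmod e + 1))) as [d2 [Hd2 H2]];
    [apply Rdiv_lt_0_compat; lra |].
  destruct (deriv_along_continuous g x d Hg d1 Hd1) as [d3 [Hd3 H3]].
  exists (Rmin (Rmin d0 d2) d3); split; [repeat apply Rmin_pos; lra |].
  intros y Hy.
  assert (Hy0 : Cmod (j y - j x) < d0 /\ Cmod (j y - j x) < d2 /\
    Cmod (j y - j x) < d3).
  { pose proof (Rmin_l (Rmin d0 d2) d3); pose proof (Rmin_r (Rmin d0 d2) d3).
    pose proof (Rmin_l d0 d2); pose proof (Rmin_r d0 d2). lra. }
  destruct Hy0 as [Y0 [Y2 Y3]].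
  specialize (H0 y Y0); specialize (H2 y Y2); specialize (H3 y Y3).
  specialize (H1 (g y) H3); simpl in H1.
  replace (k (g y) - k (g x) - e * d * (j y - j x))%C
    with ((k (g y) - k (g x) - e * (g y - g x)) +
          e * (g y - g x - d * (j y - j x)))%C by ring.
  eapply Rle_trans; [apply Cmod_triangle |]. rewrite Cmod_mult.
  set (r := Cmod (j y - j x)) in *.
  assert (A : eps / 2 / M * Cmod (g y - g x) <= eps / 2 * r).
  { replace (eps / 2 * r) with (eps / 2 / M * (M * r)) by (field; lra).
    apply Rmult_le_compat_l; [| exact H0].
    apply Rlt_le, Rdiv_lt_0_compat; lra. }
  assert (B : Cmod e * Cmod (g y - g x - d * (j y - j x)) <= eps / 2 * r).
  { apply Rle_trans with ((Cmod e + 1) * (eps / 2 / (Cmod e + 1) * r)).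
    - apply Rmult_le_compat; try apply Cmod_ge_0; lra.
    - right; field; lra. }
  lra.
Qed.

Lemma deriv_along_mult (g k : X -> C) (x : X) (d e : C) :
  deriv_along j g x d -> deriv_along j k x e ->
  deriv_along j (fun y => g y * k y)%C x (d * k x + g x * e).
Proof.
  (* Polarisation reduces the product to the square, a composition. *)
  assert (Hsq : forall z : C, cderiv (fun w => w * w)%C z (2 * z)).
  { intros z eps He; exists eps; split; [exact He |]; intros y Hy.
    replace (y * y - z * z - 2 * z * (y - z))%C
      with ((y - z) * (y - z))%C by ring.
    rewrite Cmod_mult; apply Rmult_le_compat_r; [apply Cmod_ge_0 | lra]. }
  assert (Hsc : forall c z : C, cderiv (fun w => c * w)%C z c).
  { intros c z eps He; exists 1; split; [lra |]; intros y Hy.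
    replace (c * y - c * z - c * (y - z))%C with (RtoC 0) by ring.
    rewrite Cmod_0; apply Rmult_le_pos; [lra | apply Cmod_ge_0]. }
  intros Hg Hk.
  pose proof (deriv_along_plus g k x d e Hg Hk) as P.
  pose proof (deriv_along_comp k (fun w => (-(1)) * w)%C x _ _ Hk (Hsc _ _)) as N.
  pose proof (deriv_along_plus g _ x d _ Hg N) as Q.
  pose proof (deriv_along_comp _ _ x _ _ P (Hsq _)) as P2.
  pose proof (deriv_along_comp _ _ x _ _ Q (Hsq _)) as Q2.
  pose proof (deriv_along_comp _ (fun w => (-(1)) * w)%C x _ _ Q2 (Hsc _ _)) as Q3.
  pose proof (deriv_along_plus _ _ x _ _ P2 Q3) as S.
  pose proof (deriv_along_comp _ (fun w => / (2 * 2) * w)%C x _ _ S (Hsc _ _)) as T.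
  intros eps He; destruct (T eps He) as [dl [Hd H]].
  exists dl; split; [exact Hd |]; intros y Hy; specialize (H y Hy).
  cbv beta in H.
  match goal with |- Cmod ?a <= _ => match type of H with Cmod ?b <= _ =>
    replace a with b; [exact H |] end end.
  field.
Qed.

Lemma deriv_along_scal (c : C) (g : X -> C) (x : X) (d : C) :
  deriv_along j g x d -> deriv_along j (fun y => c * g y)%C x (c * d).
Proof.
  intros H; replace (c * d)%C with (0 * g x + c * d)%C by ring.
  apply (deriv_along_mult (fun _ => c)); [apply deriv_along_const | exact H].
Qed.

Lemma deriv_along_ext (g k : X -> C) (x : X) (d : C) :
  (forall y, g y = k y) -> deriv_along j g x d -> deriv_along j k x d.
Proof.
  intros E H eps He; destruct (H eps He) as [dl [Hd Hy]].
  exists dl; split; [exact Hd |]; intros y; rewrite <- !E; apply Hy.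
Qed.

End Along.

Lemma cderiv_inv (z : C) : z <> 0 -> cderiv (fun w => / w)%C z (- / (z * z)).
Proof.
  intros Hz eps He.
  assert (Hm : 0 < Cmod z) by (apply Cmod_gt_0; exact Hz).
  exists (Rmin (Cmod z / 2) (eps * Cmod z ^ 3 / 2)); split.
  { apply Rmin_pos; [lra |]. pose proof (pow_lt _ 3 Hm). nra. }
  intros y Hy.
  pose proof (Rlt_le_trans _ _ _ Hy (Rmin_l _ _)) as Y1.
  pose proof (Rlt_le_trans _ _ _ Hy (Rmin_r _ _)) as Y2.
  assert (Hym : Cmod z / 2 <= Cmod y).
  { assert (Cmod z <= Cmod y + Cmod (y - z)); [| lra].
    replace z with (y + - (y - z))%C at 1 by ring.
    rewrite <- (Cmod_opp (y - z)); apply Cmod_triangle. }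
  assert (Hy0 : y <> 0) by (intros E; rewrite E, Cmod_0 in Hym; lra).
  replace (/ y - / z - - / (z * z) * (y - z))%C
    with ((y - z) * ((y - z) / (y * (z * z))))%C by (field; auto).
  rewrite Cmod_mult, Rmult_comm.
  apply Rmult_le_compat_r; [apply Cmod_ge_0 |].
  assert (y * (z * z) <> 0)%C by (repeat apply Cmult_neq_0; auto).
  rewrite Cmod_div, !Cmod_mult by auto.
  assert (Hp : 0 < Cmod y * (Cmod z * Cmod z)) by (apply Rmult_lt_0_compat; nra).
  apply Rle_div_l; [exact Hp |].
  apply Rle_trans with (eps * Cmod z ^ 3 / 2); [lra |].
  replace (eps * Cmod z ^ 3 / 2) with (eps * (Cmod z / 2 * (Cmod z * Cmod z))) by field.
  apply Rmult_le_compat_l; [lra |]; apply Rmult_le_compat_r; nra.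
Qed.

Lemma cderiv_ext_val (g : C -> C) (z d e : C) : d = e -> cderiv g z d -> cderiv g z e.
Proof. intros ->; auto. Qed.

Lemma cderiv_affine (al be z : C) : cderiv (fun w => al + be * w)%C z be.
Proof.
  intros eps He; exists 1; split; [lra |]; intros y _.
  replace (al + be * y - (al + be * z) - be * (y - z))%C with (RtoC 0) by ring.
  rewrite Cmod_0; apply Rmult_le_pos; [lra | apply Cmod_ge_0].
Qed.

Lemma differentiable_const (c z : C) : differentiable_at (fun _ => c) z.
Proof. exists (RtoC 0); apply deriv_along_const. Qed.

Lemma differentiable_id (z : C) : differentiable_at (fun w => w) z.
Proof. exists (RtoC 1); apply deriv_along_id. Qed.

Lemma differentiable_plus (g k : C -> C) (z : C) :
  differentiable_at g z -> differentiable_at k z ->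
  differentiable_at (fun w => g w + k w)%C z.
Proof. intros [d Hd] [e He]; eexists; apply deriv_along_plus; eassumption. Qed.

Lemma differentiable_mult (g k : C -> C) (z : C) :
  differentiable_at g z -> differentiable_at k z ->
  differentiable_at (fun w => g w * k w)%C z.
Proof. intros [d Hd] [e He]; eexists; apply deriv_along_mult; eassumption. Qed.

Lemma differentiable_comp (g k : C -> C) (z : C) :
  differentiable_at g z -> differentiable_at k (g z) ->
  differentiable_at (fun w => k (g w)) z.
Proof.
  intros [d Hd] [e He]; eexists.
  apply (deriv_along_comp _ g k z); eassumption.
Qed.

Lemma differentiable_inv (g : C -> C) (z : C) :
  differentiable_at g z -> g z <> 0 -> differentiable_at (fun w => / g w)%C z.
Proof.
  intros Hg Hz; apply (differentiable_comp g (fun w => / w)%C); [exact Hg |].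
  eexists; apply cderiv_inv, Hz.
Qed.

Lemma differentiable_iff_ex_derive (g : C -> C) (z : C) :
  differentiable_at g z <-> @ex_derive C_AbsRing C_NormedModule g z.
Proof. split; intros [d H]; exists d; apply cderiv_iff_is_derive; exact H. Qed.

Lemma holomorphic_has_derivative (g : C -> C) : holomorphic g ->
  exists dg : C -> C, forall z, half_plane z -> cderiv g z (dg z).
Proof.
  intros Hg; exists (fun z => epsilon (inhabits (RtoC 0)) (cderiv g z)).
  intros z Hz; apply epsilon_spec, Hg, Hz.
Qed.

(** Real calculus sees a complex curve through its real linear functionals
    [Re (a * _)]: [a = 1] and [a = - i] give the coordinates, and a
    well-chosen [a] gives the component in a given direction. *)
Lemma rderiv_is_derive (g : R -> C) (t : R) (v a : C) :
  rderiv g t v -> is_derive (fun s => Re (a * g s)) t (Re (a * v)).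
Proof.
  intros H; split; [apply is_linear_scal_l |].
  intros x Hx.
  assert (Ex : t = x) by
    (apply (is_filter_lim_locally_unique (V := R_NormedModule) t x Hx)).
  subst x. intros eps.
  assert (Hp : 0 < Cmod a + 1) by (pose proof (Cmod_ge_0 a); lra).
  destruct (H (eps / (Cmod a + 1))) as [dl [Hd Hw]].
  { apply Rdiv_lt_0_compat; [apply cond_pos | lra]. }
  exists (mkposreal dl Hd); intros y Hy.
  assert (E : forall u : R, Cmod (RtoC u - RtoC t) = Rabs (u - t))
    by (intros u; rewrite <- RtoC_minus, Cmod_R; reflexivity).
  specialize (Hw y). rewrite E in Hw. specialize (Hw Hy).
  change (Rabs (Re (a * g y) - Re (a * g t) - (y - t) * Re (a * v))
    <= eps * Rabs (y - t)).
  replace (Re (a * g y) - Re (a * g t) - (y - t) * Re (a * v))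
    with (Re (a * (g y - g t - v * (RtoC y - RtoC t)))).
  2:{ destruct a, v, (g y), (g t); simpl; ring. }
  eapply Rle_trans; [apply re_le_Cmod |]. rewrite Cmod_mult.
  apply Rle_trans with ((Cmod a + 1) * (eps / (Cmod a + 1) * Rabs (y - t))).
  - apply Rmult_le_compat; try apply Cmod_ge_0; try lra; exact Hw.
  - right; field; lra.
Qed.

Lemma rderiv_line (a v : C) (t : R) : rderiv (fun s => a + RtoC s * v)%C t v.
Proof.
  intros eps He; exists 1; split; [lra |]; intros y _.
  replace (a + RtoC y * v - (a + RtoC t * v) - v * (RtoC y - RtoC t))%C
    with (RtoC 0) by ring.
  rewrite Cmod_0; apply Rmult_le_pos; [lra | apply Cmod_ge_0].
Qed.

(** * Goursat's theorem and primitives on the half-plane *)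

Lemma norm_C_R (z : C) : norm (V := C_R_NormedModule) z = Cmod z.
Proof.
  change (sqrt (Rabs (fst z) ^ 2 + Rabs (snd z) ^ 2) = Cmod z).
  rewrite !pow2_abs; reflexivity.
Qed.

Lemma rderiv_is_derive_C (g : R -> C) (t : R) (v : C) :
  rderiv g t v -> is_derive (V := C_R_NormedModule) g t v.
Proof.
  intros H; split; [apply is_linear_scal_l |].
  intros x Hx.
  assert (Ex : t = x) by
    (apply (is_filter_lim_locally_unique (V := R_NormedModule) t x Hx)).
  subst x. intros eps.
  destruct (H eps (cond_pos eps)) as [dl [Hd Hw]].
  exists (mkposreal dl Hd); intros y Hy.
  specialize (Hw y). rewrite <- RtoC_minus, Cmod_R in Hw. specialize (Hw Hy).
  rewrite norm_C_R.
  apply Rle_trans with (2 := Hw), Req_le, f_equal.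
  destruct (g y), (g t), v.
  unfold minus, plus, opp, scal, mult; simpl.
  unfold Cminus, Cplus, Copp, Cmult, RtoC, prod_plus, prod_opp, prod_scal; simpl.
  unfold plus, opp, scal, mult; simpl; unfold mult; simpl.
  f_equal; ring.
Qed.

Lemma rderiv_continuous (g : R -> C) (t : R) (v : C) :
  rderiv g t v -> continuous (U := C_R_NormedModule) g t.
Proof.
  intros H; apply (ex_derive_continuous (V := C_R_NormedModule)).
  exists v; apply rderiv_is_derive_C; exact H.
Qed.

(** The integral of [g z dz] along a segment. Carrying the direction [v] as
    a parameter lets the horizontal and the vertical sides of a rectangle share
    their lemmas. *)
Definition segment_integral (g : C -> C) (a v : C) (s0 s1 : R) : C :=
  RInt (V := C_R_CompleteNormedModule) (fun s => g (a + RtoC s * v)%C * v)%C s0 s1.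

Lemma segment_integral_integrand_rderiv (g : C -> C) (a v : C) (s : R) :
  differentiable_at g (a + RtoC s * v)%C ->
  exists d, rderiv (fun s => g (a + RtoC s * v)%C * v)%C s d.
Proof.
  intros [d H]. eexists.
  apply deriv_along_mult; [| apply deriv_along_const].
  apply (deriv_along_comp RtoC (fun s => a + RtoC s * v)%C g s v d);
    [apply rderiv_line | exact H].
Qed.

Lemma segment_integral_ex (g : C -> C) (a v : C) (s0 s1 : R) :
  (forall s, Rmin s0 s1 <= s <= Rmax s0 s1 ->
     differentiable_at g (a + RtoC s * v)%C) ->
  ex_RInt (V := C_R_CompleteNormedModule) (fun s => g (a + RtoC s * v)%C * v)%C s0 s1.
Proof.
  intros H; apply ex_RInt_continuous; intros s Hs.
  destruct (segment_integral_integrand_rderiv g a v s (H s Hs)) as [d Hd].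
  exact (rderiv_continuous _ _ _ Hd).
Qed.

Lemma segment_integral_Chasles (g : C -> C) (a v : C) (s0 s1 s2 : R) :
  s0 <= s1 <= s2 ->
  (forall s, s0 <= s <= s2 -> differentiable_at g (a + RtoC s * v)%C) ->
  (segment_integral g a v s0 s2 = segment_integral g a v s0 s1 + segment_integral g a v s1 s2)%C.
Proof.
  intros Hs H; unfold segment_integral; symmetry.
  apply (RInt_Chasles (V := C_R_CompleteNormedModule)); apply segment_integral_ex; intros s;
    rewrite Rmin_left, Rmax_right by lra; intros ?; apply H; lra.
Qed.

Lemma segment_integral_swap (g : C -> C) (a v : C) (s0 s1 : R) :
  (forall s, Rmin s0 s1 <= s <= Rmax s0 s1 ->
     differentiable_at g (a + RtoC s * v)%C) ->
  (segment_integral g a v s1 s0 = - segment_integral g a v s0 s1)%C.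
Proof.
  intros H; unfold segment_integral; symmetry.
  exact (opp_RInt_swap (V := C_R_CompleteNormedModule) _ s0 s1 (segment_integral_ex g a v s0 s1 H)).
Qed.

(** The integral of [g] is compared with the increment of a primitive [Q] of
    a function [q] close to [g]. With [q] affine this is the local estimate in
    Goursat's theorem; with [q] constant it differentiates the primitive. *)
Lemma segment_integral_near (g Q q : C -> C) (a v : C) (s0 s1 M : R) :
  Cmod v = 1 ->
  (forall s, Rmin s0 s1 <= s <= Rmax s0 s1 ->
     differentiable_at g (a + RtoC s * v)%C) ->
  (forall z, cderiv Q z (q z)) -> (forall z, differentiable_at q z) ->
  (forall s, Rmin s0 s1 <= s <= Rmax s0 s1 ->
     Cmod (g (a + RtoC s * v)%C - q (a + RtoC s * v)%C) <= M) ->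
  Cmod (segment_integral g a v s0 s1 - (Q (a + RtoC s1 * v)%C - Q (a + RtoC s0 * v)%C))
    <= Rabs (s1 - s0) * M.
Proof.
  intros Hv Hg HQ Hq HM.
  pose proof (segment_integral_ex g a v s0 s1 Hg) as Eg; apply RInt_correct in Eg.
  pose proof (is_RInt_derive (V := C_R_CompleteNormedModule)
    (fun s => Q (a + RtoC s * v)%C) (fun s => q (a + RtoC s * v)%C * v)%C s0 s1) as Eq.
  assert (D : is_RInt (V := C_R_CompleteNormedModule)
    (fun s => minus (g (a + RtoC s * v)%C * v)%C (q (a + RtoC s * v)%C * v)%C) s0 s1
    (minus (segment_integral g a v s0 s1) (minus (Q (a + RtoC s1 * v)%C) (Q (a + RtoC s0 * v)%C)))).
  { apply (is_RInt_minus (V := C_R_CompleteNormedModule)); [exact Eg | apply Eq].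
    - intros s Hs; apply rderiv_is_derive_C.
      apply (deriv_along_comp RtoC (fun s => a + RtoC s * v)%C Q s v);
        [apply rderiv_line | apply HQ].
    - intros s Hs; destruct (segment_integral_integrand_rderiv q a v s (Hq _)) as [d Hd].
      exact (rderiv_continuous _ _ _ Hd). }
  apply norm_RInt_le_const_abs with (M := M) in D.
  - rewrite (norm_C_R (minus _ _)) in D. exact D.
  - intros s Hs. rewrite (norm_C_R (minus _ _)).
    change (Cmod (g (a + RtoC s * v)%C * v - q (a + RtoC s * v)%C * v) <= M).
    replace (g (a + RtoC s * v)%C * v - q (a + RtoC s * v)%C * v)%C
      with ((g (a + RtoC s * v)%C - q (a + RtoC s * v)%C) * v)%C by ring.
    rewrite Cmod_mult, Hv, Rmult_1_r; apply HM, Hs.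
Qed.

Lemma intervals_meet {I : Type} (i0 : I) (u v : I -> R) :
  (forall i k, u i <= v k) -> exists x, forall i, u i <= x <= v i.
Proof.
  intros H.
  destruct (completeness (fun x => exists i, x = u i)) as [x [Hx1 Hx2]].
  - exists (v i0); intros y [i ->]; apply H.
  - exists (u i0), i0; reflexivity.
  - exists x; intros i; split; [apply Hx1; exists i; reflexivity |].
    apply Hx2; intros y [k ->]; apply H.
Qed.

Lemma nested_intervals (u v : nat -> R) :
  (forall n, u n <= u (S n)) -> (forall n, v (S n) <= v n) ->
  (forall n, u n <= v n) -> exists x, forall n, u n <= x <= v n.
Proof.
  intros Hu Hv Huv.
  assert (Mu : forall n p, u n <= u (n + p)%nat).
  { intros n p; induction p; [rewrite Nat.add_0_r; lra |].
    rewrite Nat.add_succ_r; specialize (Hu (n + p)%nat); lra. }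
  assert (Mv : forall n p, v (n + p)%nat <= v n).
  { intros n p; induction p; [rewrite Nat.add_0_r; lra |].
    rewrite Nat.add_succ_r; specialize (Hv (n + p)%nat); lra. }
  apply (intervals_meet O); intros p n.
  specialize (Mu p n); specialize (Mv n p); specialize (Huv (p + n)%nat).
  rewrite (Nat.add_comm n p) in Mv; lra.
Qed.

(** A property of rectangles, inherited from the four quarters, holds as
    soon as it holds for the small rectangles around each point: otherwise
    quartering produces a nested sequence of bad rectangles shrinking to a
    point. The rectangles keep the proportions [l : m] of the first one and are
    given by a corner and a scale [r], since quarters then differ from their
    parent only by the factor 1/2 in [r]. *)
Lemma bisection_2d (Q : R -> R -> R -> Prop) (a0 c0 l m : R) :
  0 <= l -> 0 <= m ->
  (forall a c r, a0 <= a -> 0 < r ->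
     Q a c (r / 2) -> Q (a + r / 2 * l) c (r / 2) ->
     Q a (c + r / 2 * m) (r / 2) -> Q (a + r / 2 * l) (c + r / 2 * m) (r / 2) ->
     Q a c r) ->
  (forall x y, a0 <= x -> exists delta, 0 < delta /\
     forall a c r, a0 <= a -> 0 < r < delta -> a <= x <= a + r * l ->
       c <= y <= c + r * m -> Q a c r) ->
  Q a0 c0 1.
Proof.
  intros Hl Hm Hsplit Hloc.
  apply NNPP; intros Hbad.
  assert (Hch : forall a c r, a0 <= a -> 0 < r -> ~ Q a c r ->
    exists p : R * R, (a <= fst p <= a + r / 2 * l) /\
      (c <= snd p <= c + r / 2 * m) /\ ~ Q (fst p) (snd p) (r / 2)).
  { intros a c r Ha Hr Hb; apply NNPP; intros Hn; apply Hb.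
    assert (0 <= r / 2 * l) by (apply Rmult_le_pos; lra).
    assert (0 <= r / 2 * m) by (apply Rmult_le_pos; lra).
    assert (N : forall x y, a <= x <= a + r / 2 * l -> c <= y <= c + r / 2 * m ->
      Q x y (r / 2)).
    { intros x y Hx Hy; apply NNPP; intros Hq; apply Hn; exists (x, y); auto. }
    apply Hsplit; auto; apply N; lra. }
  set (next := fun (r : R) (p : R * R) => epsilon (inhabits (0, 0))
    (fun p' : R * R => (fst p <= fst p' <= fst p + r / 2 * l) /\
      (snd p <= snd p' <= snd p + r / 2 * m) /\ ~ Q (fst p') (snd p') (r / 2))).
  set (st := fix st (n : nat) : R * R :=
    match n with O => (a0, c0) | S k => next ((1 / 2) ^ k) (st k) end).
  assert (Hr : forall n, 0 < (1 / 2) ^ n) by (intros; apply pow_lt; lra).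
  assert (Inv : forall n, a0 <= fst (st n) /\ ~ Q (fst (st n)) (snd (st n)) ((1 / 2) ^ n)).
  { induction n as [| n [IH1 IH2]]; [simpl; split; [lra | exact Hbad] |].
    pose proof (epsilon_spec (inhabits (0, 0)) _ (Hch _ _ _ IH1 (Hr n) IH2)) as Sp.
    change (epsilon _ _) with (st (S n)) in Sp.
    destruct Sp as [S1 [S2 S3]]; split; [lra |].
    replace ((1 / 2) ^ S n) with ((1 / 2) ^ n / 2) by (simpl; field); exact S3. }
  assert (Stp : forall n,
    (fst (st n) <= fst (st (S n)) <= fst (st n) + (1 / 2) ^ n / 2 * l) /\
    (snd (st n) <= snd (st (S n)) <= snd (st n) + (1 / 2) ^ n / 2 * m)).
  { intros n; destruct (Inv n) as [I1 I2].
    pose proof (epsilon_spec (inhabits (0, 0)) _ (Hch _ _ _ I1 (Hr n) I2)) as Sp.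
    change (epsilon _ _) with (st (S n)) in Sp.
    split; apply Sp. }
  assert (Pw : forall n, (1 / 2) ^ S n = (1 / 2) ^ n / 2) by (intros; simpl; field).
  destruct (nested_intervals (fun n => fst (st n)) (fun n => fst (st n) + (1 / 2) ^ n * l))
    as [x Hx].
  { intros n; apply Stp. }
  { intros n; specialize (Stp n); rewrite Pw; lra. }
  { intros n; specialize (Hr n); nra. }
  destruct (nested_intervals (fun n => snd (st n)) (fun n => snd (st n) + (1 / 2) ^ n * m))
    as [y Hy].
  { intros n; apply Stp. }
  { intros n; specialize (Stp n); rewrite Pw; lra. }
  { intros n; specialize (Hr n); nra. }
  destruct (Hloc x y) as [dl [Hd HQ]].
  { specialize (Hx O); simpl in Hx; lra. }
  destruct (pow_lt_1_zero (1 / 2)) with (y := dl) as [n Hn];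
    [rewrite Rabs_pos_eq; lra | exact Hd |].
  specialize (Hn n (Nat.le_refl n)). rewrite Rabs_pos_eq in Hn by (apply Rlt_le, Hr).
  apply (Inv n), HQ; auto. apply Inv.
Qed.

Definition rect_int (g : C -> C) (a b c d : R) : C :=
  (segment_integral g (Ci * RtoC c) 1 a b + segment_integral g (RtoC b) Ci c d
   - segment_integral g (Ci * RtoC d) 1 a b - segment_integral g (RtoC a) Ci c d)%C.

Lemma Re_horizontal (s c : R) : Re (Ci * RtoC c + RtoC s * 1)%C = s.
Proof. simpl; ring. Qed.

Lemma Re_vertical (s b : R) : Re (RtoC b + RtoC s * Ci)%C = b.
Proof. simpl; ring. Qed.

Lemma holomorphic_horizontal (g : C -> C) (y s0 s1 : R) :
  holomorphic g -> 0 < s0 -> 0 < s1 -> forall s,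
  Rmin s0 s1 <= s <= Rmax s0 s1 -> differentiable_at g (Ci * RtoC y + RtoC s * 1)%C.
Proof.
  intros Hg H0 H1 s Hs; apply Hg; unfold half_plane; rewrite Re_horizontal.
  pose proof (Rmin_pos s0 s1 H0 H1); lra.
Qed.

Lemma holomorphic_vertical (g : C -> C) (x s0 s1 : R) :
  holomorphic g -> 0 < x -> forall s,
  Rmin s0 s1 <= s <= Rmax s0 s1 -> differentiable_at g (RtoC x + RtoC s * Ci)%C.
Proof.
  intros Hg H0 s Hs; apply Hg; unfold half_plane; rewrite Re_vertical; lra.
Qed.

Lemma rect_int_split_h (g : C -> C) (a b b' c d : R) :
  holomorphic g -> 0 < a -> a <= b <= b' ->
  (rect_int g a b' c d = rect_int g a b c d + rect_int g b b' c d)%C.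
Proof.
  intros Hg Ha Hb; unfold rect_int.
  rewrite (segment_integral_Chasles g (Ci * RtoC c) 1 a b b'), (segment_integral_Chasles g (Ci * RtoC d) 1 a b b');
    try exact Hb.
  - ring.
  - intros s Hs; apply Hg; unfold half_plane; rewrite Re_horizontal; lra.
  - intros s Hs; apply Hg; unfold half_plane; rewrite Re_horizontal; lra.
Qed.

Lemma rect_int_split_v (g : C -> C) (a b c d d' : R) :
  holomorphic g -> 0 < a <= b -> c <= d <= d' ->
  (rect_int g a b c d' = rect_int g a b c d + rect_int g a b d d')%C.
Proof.
  intros Hg Ha Hb; unfold rect_int.
  rewrite (segment_integral_Chasles g (RtoC a) Ci c d d'), (segment_integral_Chasles g (RtoC b) Ci c d d');
    try exact Hb.
  - ring.
  - intros s Hs; apply Hg; unfold half_plane; rewrite Re_vertical; lra.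
  - intros s Hs; apply Hg; unfold half_plane; rewrite Re_vertical; lra.
Qed.

Lemma cderiv_affine_primitive (al be p z : C) :
  cderiv (fun w => w * (al + be / 2 * (w - 2 * p)))%C z (al + be * (z - p)).
Proof.
  eapply cderiv_ext_val;
    [| apply (deriv_along_mult (fun w : C => w) (fun w => w)
         (fun w => al + be / 2 * (w - 2 * p))%C z 1 (be / 2)%C)].
  - field.
  - apply deriv_along_id.
  - apply (deriv_along_ext _ (fun w => (al - be * p) + be / 2 * w)%C).
    + intros y; field.
    + apply cderiv_affine.
Qed.

(** Removing from [g] its first-order expansion at [p], which has a
    primitive, leaves an integrand that is o(diameter) on a perimeter of the
    order of the diameter. *)
Lemma rect_int_small (g : C -> C) (eps l m : R) (p : C) :
  holomorphic g -> half_plane p -> 0 < eps -> 0 <= l -> 0 <= m ->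
  exists delta, 0 < delta /\ forall a c r, 0 < a -> 0 < r < delta ->
    a <= Re p <= a + r * l -> c <= Im p <= c + r * m ->
    Cmod (rect_int g a (a + r * l) c (c + r * m)) <= eps * r ^ 2.
Proof.
  intros Hg Hp He Hl Hm.
  destruct (Hg p Hp) as [be Hbe].
  (* The perimeter is 2 r (l + m) and the integrand at most eta r (l + m); the
     + 1 covers a degenerate rectangle. *)
  set (eta := eps / (2 * ((l + m) ^ 2 + 1))).
  assert (Hs : 0 < 2 * ((l + m) ^ 2 + 1)) by (pose proof (pow2_ge_0 (l + m)); lra).
  assert (Heta : 0 < eta) by (apply Rdiv_lt_0_compat; lra).
  destruct (Hbe eta Heta) as [dl [Hd H]].
  exists (dl / (l + m + 1)); split; [apply Rdiv_lt_0_compat; lra |].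
  intros a c r Ha Hr Hx Hy.
  set (b := a + r * l) in *; set (d := c + r * m) in *.
  assert (Hrl : 0 <= r * l) by (apply Rmult_le_pos; lra).
  assert (Hrm : 0 <= r * m) by (apply Rmult_le_pos; lra).
  set (al := g p).
  set (q := fun w : C => (al + be * (w - p))%C).
  set (Q := fun w : C => (w * (al + be / 2 * (w - 2 * p)))%C).
  set (M := eta * (r * l + r * m)).
  assert (HM0 : 0 <= M) by (apply Rmult_le_pos; lra).
  assert (HQ : forall z, cderiv Q z (q z)) by (intros; apply cderiv_affine_primitive).
  assert (Hq : forall z, differentiable_at q z).
  { intros z; exists be; apply (deriv_along_ext _ (fun w => (al - be * p) + be * w)%C).
    - intros y; unfold q; ring.
    - apply cderiv_affine. }
  assert (HM : forall w, a <= Re w <= b -> c <= Im w <= d -> Cmod (g w - q w) <= M).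
  { intros w Hw1 Hw2.
    assert (Hdist : Cmod (w - p) <= r * l + r * m).
    { eapply Rle_trans; [apply Cmod_re_im |].
      apply Rplus_le_compat; apply Rabs_le.
      - change (Re (w - p)%C) with (Re w - Re p). unfold b in *; lra.
      - change (Im (w - p)%C) with (Im w - Im p). unfold d in *; lra. }
    unfold q, M; replace (g w - (al + be * (w - p)))%C
      with (g w - g p - be * (w - p))%C by (unfold al; ring).
    eapply Rle_trans; [apply H |].
    - apply (Rle_lt_trans _ _ _ Hdist).
      destruct Hr as [Hr0 Hr1]. apply Rlt_div_r in Hr1; [nra | lra].
    - apply Rmult_le_compat_l; lra. }
  assert (Hh : forall y, c <= y <= d ->
    Cmod (segment_integral g (Ci * RtoC y) 1 a b - (Q (Ci * RtoC y + RtoC b * 1)%C - Q (Ci * RtoC y + RtoC a * 1)%C))%C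
      <= r * l * M).
  { intros y Hyy.
    replace (r * l) with (Rabs (b - a)) by (unfold b; rewrite Rabs_pos_eq; lra).
    assert (a <= b) by (unfold b; lra).
    apply segment_integral_near with (q := q); auto; [apply Cmod_1 | |]; intros s;
      rewrite Rmin_left, Rmax_right by lra; intros Hss.
    - apply Hg; unfold half_plane; rewrite Re_horizontal; lra.
    - apply HM; [rewrite Re_horizontal; lra | simpl; lra]. }
  assert (Hv : forall x, a <= x <= b ->
    Cmod (segment_integral g (RtoC x) Ci c d - (Q (RtoC x + RtoC d * Ci)%C - Q (RtoC x + RtoC c * Ci)%C))%C
      <= r * m * M).
  { intros x Hxx.
    replace (r * m) with (Rabs (d - c)) by (unfold d; rewrite Rabs_pos_eq; lra).
    assert (c <= d) by (unfold d; lra).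
    apply segment_integral_near with (q := q); auto; [apply Cmod_Ci | |]; intros s;
      rewrite Rmin_left, Rmax_right by lra; intros Hss.
    - apply Hg; unfold half_plane; rewrite Re_vertical; lra.
    - apply HM; [rewrite Re_vertical; lra | simpl; lra]. }
  assert (Hac : a <= b) by (unfold b; lra).
  assert (Hcd : c <= d) by (unfold d; lra).
  pose proof (Hh c ltac:(lra)) as H1; pose proof (Hh d ltac:(lra)) as H3.
  pose proof (Hv a ltac:(lra)) as H4; pose proof (Hv b ltac:(lra)) as H2.
  assert (Corner : forall x y, (Ci * RtoC y + RtoC x * 1 = RtoC x + RtoC y * Ci)%C)
    by (intros; ring).
  rewrite !Corner in H1, H3.
  set (A1 := (_ - _)%C) in H1; set (A2 := (_ - _)%C) in H2.
  set (A3 := (_ - _)%C) in H3; set (A4 := (_ - _)%C) in H4.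
  replace (rect_int g a b c d) with (A1 + A2 - A3 - A4)%C
    by (unfold A1, A2, A3, A4, rect_int; ring).
  apply Rle_trans with (Cmod A1 + Cmod A2 + Cmod A3 + Cmod A4).
  { unfold Cminus.
    eapply Rle_trans; [apply Cmod_triangle |]; rewrite Cmod_opp.
    apply Rplus_le_compat_r.
    eapply Rle_trans; [apply Cmod_triangle |]; rewrite Cmod_opp.
    apply Rplus_le_compat_r, Cmod_triangle. }
  apply Rle_trans with (2 * (r * l + r * m) * M); [lra |].
  unfold M; replace (2 * (r * l + r * m) * (eta * (r * l + r * m)))
    with (eps * r ^ 2 * (2 * (l + m) ^ 2 / (2 * ((l + m) ^ 2 + 1))))
    by (unfold eta; field; lra).
  rewrite <- (Rmult_1_r (eps * r ^ 2)) at 2.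
  apply Rmult_le_compat_l; [pose proof (pow2_ge_0 r); nra |].
  apply Rle_div_l; lra.
Qed.

Lemma goursat_ordered (g : C -> C) (a b c d : R) :
  holomorphic g -> 0 < a <= b -> c <= d -> rect_int g a b c d = RtoC 0.
Proof.
  intros Hg Ha Hc. apply Cmod_eq_0, Rle_antisym; [| apply Cmod_ge_0].
  apply le_epsilon; intros eps He. rewrite Rplus_0_l.
  set (l := b - a); set (m := d - c).
  assert (B : Cmod (rect_int g a (a + 1 * l) c (c + 1 * m)) <= eps * 1 ^ 2).
  { apply (bisection_2d (fun a c r =>
      Cmod (rect_int g a (a + r * l) c (c + r * m)) <= eps * r ^ 2) a c l m);
      try (unfold l, m; lra).
    - intros a' c' r Ha' Hr H1 H2 H3 H4.
      assert (0 <= r / 2 * l) by (apply Rmult_le_pos; unfold l; lra).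
      assert (0 <= r / 2 * m) by (apply Rmult_le_pos; unfold m; lra).
      rewrite (rect_int_split_h g a' (a' + r / 2 * l)) by (auto; lra).
      rewrite (rect_int_split_v g a' _ c' (c' + r / 2 * m)) by (auto; lra).
      rewrite (rect_int_split_v g (a' + r / 2 * l) _ c' (c' + r / 2 * m)) by (auto; lra).
      replace (a' + r / 2 * l + r / 2 * l) with (a' + r * l) in H2, H4 by field.
      replace (c' + r / 2 * m + r / 2 * m) with (c' + r * m) in H3, H4 by field.
      eapply Rle_trans; [apply Cmod_triangle |].
      eapply Rle_trans; [apply Rplus_le_compat; apply Cmod_triangle |].
      replace (eps * r ^ 2) with (4 * (eps * (r / 2) ^ 2)) by field. lra.
    - intros x y Hx.
      destruct (rect_int_small g eps l m (x, y)) as [dl [Hd H]];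
        try (unfold l, m; lra); auto.
      { unfold half_plane; simpl; lra. }
      exists dl; split; [exact Hd |]; intros; apply H; auto; lra. }
  replace (a + 1 * l) with b in B by (unfold l; ring).
  replace (c + 1 * m) with d in B by (unfold m; ring). lra.
Qed.

(** The orientation conventions of the integral make the order of the
    endpoints irrelevant. *)
Lemma goursat (g : C -> C) (a b c d : R) :
  holomorphic g -> 0 < a -> 0 < b -> rect_int g a b c d = RtoC 0.
Proof.
  intros Hg Ha Hb.
  assert (Sh : rect_int g a b c d = (- rect_int g b a c d)%C).
  { unfold rect_int; rewrite (segment_integral_swap g (Ci * RtoC c) 1 a b),
      (segment_integral_swap g (Ci * RtoC d) 1 a b)
      by (apply holomorphic_horizontal; auto); ring. }
  assert (Sv : forall a b, 0 < a -> 0 < b ->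
    rect_int g a b c d = (- rect_int g a b d c)%C).
  { intros a' b' Ha' Hb'; unfold rect_int; rewrite (segment_integral_swap g (RtoC a') Ci c d),
      (segment_integral_swap g (RtoC b') Ci c d)
      by (apply holomorphic_vertical; auto); ring. }
  assert (Z : (- RtoC 0)%C = RtoC 0) by ring.
  destruct (Rle_dec a b), (Rle_dec c d).
  - apply goursat_ordered; auto.
  - rewrite Sv, goursat_ordered by (auto; lra); exact Z.
  - rewrite Sh, goursat_ordered by (auto; lra); exact Z.
  - rewrite Sh, Sv, goursat_ordered by (auto; lra); ring.
Qed.

(** The primitive integrates from 1 horizontally, then vertically. Goursat's
    theorem turns any increment into an integral over a short path. *)
Lemma primitive_exists (g : C -> C) :
  holomorphic g -> exists P : C -> C, forall z, half_plane z -> cderiv P z (g z).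
Proof.
  intros Hg.
  exists (fun z => segment_integral g (Ci * RtoC 0) 1 1 (Re z) + segment_integral g (RtoC (Re z)) Ci 0 (Im z))%C.
  intros z Hz eps He.
  destruct (Hg z Hz) as [be Hbe].
  destruct (deriv_along_continuous _ g z be Hbe (eps / 2)) as [dl [Hd Hc]]; [lra |].
  exists (Rmin dl (Re z)); split; [apply Rmin_pos; auto |].
  intros w Hw.
  pose proof (Rlt_le_trans _ _ _ Hw (Rmin_l _ _)) as W1.
  pose proof (Rlt_le_trans _ _ _ Hw (Rmin_r _ _)) as W2.
  assert (R1 : Rabs (Re w - Re z) <= Cmod (w - z)) by apply (re_le_Cmod (w - z)%C).
  assert (R2 : Rabs (Im w - Im z) <= Cmod (w - z)) by apply (im_le_Cmod (w - z)%C).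
  unfold half_plane in Hz.
  assert (Hw0 : 0 < Re w) by (apply Rabs_le_between in R1; lra).
  set (x := Re z) in *; set (y := Im z) in *; set (x' := Re w) in *; set (y' := Im w) in *.
  (* By Goursat the increment is the integral over a horizontal and a vertical
     segment joining z to w. *)
  assert (Inc : (segment_integral g (Ci * RtoC 0) 1 1 x' + segment_integral g (RtoC x') Ci 0 y' -
     (segment_integral g (Ci * RtoC 0) 1 1 x + segment_integral g (RtoC x) Ci 0 y) =
     segment_integral g (RtoC x) Ci y y' + segment_integral g (Ci * RtoC y') 1 x x')%C).
  { assert (C1 : (segment_integral g (Ci * RtoC 0) 1 1 x + segment_integral g (Ci * RtoC 0) 1 x x' =
      segment_integral g (Ci * RtoC 0) 1 1 x')%C)
      by (apply (RInt_Chasles (V := C_R_CompleteNormedModule)); apply segment_integral_ex, holomorphic_horizontal; auto; lra).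
    assert (C2 : (segment_integral g (RtoC x) Ci 0 y + segment_integral g (RtoC x) Ci y y' =
      segment_integral g (RtoC x) Ci 0 y')%C)
      by (apply (RInt_Chasles (V := C_R_CompleteNormedModule)); apply segment_integral_ex, holomorphic_vertical; auto; lra).
    pose proof (goursat g x x' 0 y' Hg Hz Hw0) as G; unfold rect_int in G.
    rewrite <- C1.
    set (r := segment_integral g (RtoC x) Ci y y') in *.
    replace r with (segment_integral g (RtoC x) Ci 0 y' - segment_integral g (RtoC x) Ci 0 y)%C
      by (rewrite <- C2; ring).
    match type of G with ?e = _ =>
      match goal with |- ?l = ?r => replace l with (r + e)%C by ring end end.
    rewrite G; ring. }
  rewrite Inc.
  assert (Hloc : forall u, Rabs (Re u - x) <= Rabs (x' - x) ->
    Rabs (Im u - y) <= Rabs (y' - y) -> Cmod (u - z) <= Cmod (w - z)).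
  { intros u U1 U2. unfold Cmod; apply sqrt_le_1_alt.
    change (fst (u - z)%C) with (Re u - x); change (snd (u - z)%C) with (Im u - y).
    change (fst (w - z)%C) with (x' - x); change (snd (w - z)%C) with (y' - y).
    apply Rplus_le_compat; apply (pow_maj_Rabs _ _ 2) in U1; apply (pow_maj_Rabs _ _ 2) in U2;
      rewrite pow2_abs in U1, U2; assumption. }
  assert (Btw : forall s0 s1 s, Rmin s0 s1 <= s <= Rmax s0 s1 ->
    Rabs (s - s0) <= Rabs (s1 - s0)).
  { intros s0 s1 s Hs; unfold Rmin, Rmax in Hs; destruct (Rle_dec s0 s1);
      unfold Rabs; destruct (Rcase_abs (s - s0)), (Rcase_abs (s1 - s0)); lra. }
  assert (Q1 : forall u, cderiv (fun w => 0 + g z * w)%C u (g z)) by (intros; apply cderiv_affine).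
  assert (Q2 : forall u, differentiable_at (fun _ : C => g z) u)
    by (intros; exists (RtoC 0); apply deriv_along_const).
  assert (V1 : Cmod (segment_integral g (RtoC x) Ci y y' -
    ((0 + g z * (RtoC x + RtoC y' * Ci)) - (0 + g z * (RtoC x + RtoC y * Ci)))) <=
    Rabs (y' - y) * (eps / 2)).
  { apply (segment_integral_near g (fun w => 0 + g z * w)%C (fun _ => g z));
      [apply Cmod_Ci | apply holomorphic_vertical; auto | exact Q1 | exact Q2 |].
    intros s Hs; left; apply Hc.
    apply Rle_lt_trans with (2 := W1), Hloc; simpl.
    - replace (x + (s * 0 - 0 * 1) - x) with 0 by ring; rewrite Rabs_R0; apply Rabs_pos.
    - replace (0 + (s * 1 + 0 * 0) - y) with (s - y) by ring; auto. }
  assert (V2 : Cmod (segment_integral g (Ci * RtoC y') 1 x x' -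
    ((0 + g z * (Ci * RtoC y' + RtoC x' * 1)) - (0 + g z * (Ci * RtoC y' + RtoC x * 1)))) <=
    Rabs (x' - x) * (eps / 2)).
  { apply (segment_integral_near g (fun w => 0 + g z * w)%C (fun _ => g z));
      [apply Cmod_1 | apply holomorphic_horizontal; auto | exact Q1 | exact Q2 |].
    intros s Hs; left; apply Hc.
    apply Rle_lt_trans with (2 := W1), Hloc; simpl.
    - replace (0 * y' - 1 * 0 + (s * 1 - 0 * 0) - x) with (s - x) by ring; auto.
    - replace (0 * 0 + 1 * y' + (s * 0 + 0 * 1) - y) with (y' - y) by ring; lra. }
  assert (Ew : w = (RtoC x' + RtoC y' * Ci)%C).
  { apply injective_projections; unfold x', y', Re, Im; simpl; ring. }
  assert (Ez : z = (RtoC x + RtoC y * Ci)%C).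
  { apply injective_projections; unfold x, y, Re, Im; simpl; ring. }
  match type of V1 with Cmod ?e1 <= _ => match type of V2 with Cmod ?e2 <= _ =>
    match goal with |- Cmod ?l <= _ => replace l with (e1 + e2)%C end end end.
  2:{ assert (E : (w - z = RtoC x' + RtoC y' * Ci - (RtoC x + RtoC y * Ci))%C)
        by (rewrite <- Ew, <- Ez; reflexivity).
      rewrite E; ring. }
  eapply Rle_trans; [apply Cmod_triangle |]. nra.
Qed.

(** * Mean value theorems *)

Lemma half_plane_convex (z w : C) (t : R) :
  half_plane z -> half_plane w -> 0 <= t <= 1 ->
  half_plane (z + RtoC t * (w - z))%C.
Proof.
  unfold half_plane; intros Hz Hw Ht.
  replace (Re (z + RtoC t * (w - z))%C) with ((1 - t) * Re z + t * Re w)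
    by (unfold Re; simpl; ring).
  destruct (Req_dec t 0) as [-> | ]; [lra |].
  assert (0 < t * Re w) by (apply Rmult_lt_0_compat; lra).
  assert (0 <= (1 - t) * Re z) by (apply Rmult_le_pos; lra). lra.
Qed.

Lemma rderiv_segment (g : C -> C) (z v d : C) (t : R) :
  cderiv g (z + RtoC t * v)%C d ->
  rderiv (fun s => g (z + RtoC s * v)%C) t (d * v).
Proof.
  intros H; apply (deriv_along_comp RtoC (fun s => z + RtoC s * v)%C g t v d);
    [apply rderiv_line | exact H].
Qed.

Lemma is_derive_continuity (u : R -> R) (t l : R) : is_derive u t l -> continuity_pt u t.
Proof.
  intros H; apply continuity_pt_filterlim, (ex_derive_continuous u t).
  exists l; exact H.
Qed.

Lemma mean_value_curve (g dg : R -> C) (a : C) (s0 s1 : R) :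
  s0 <= s1 -> (forall t, s0 <= t <= s1 -> rderiv g t (dg t)) ->
  exists t, s0 <= t <= s1 /\ Re (a * (g s1 - g s0)) = Re (a * dg t) * (s1 - s0).
Proof.
  intros Hs Hg.
  pose proof (fun t Ht => rderiv_is_derive g t (dg t) a (Hg t Ht)) as D.
  destruct (MVT_gen (fun s => Re (a * g s)) s0 s1 (fun s => Re (a * dg s)))
    as [t [Ht E]]; rewrite ?Rmin_left, ?Rmax_right in * by lra.
  - intros s Hs'; apply D; lra.
  - intros s Hs'; exact (is_derive_continuity _ _ _ (D s Hs')).
  - exists t; split; [exact Ht |]. rewrite <- E. unfold Re; simpl; ring.
Qed.

Lemma mean_value_segment (g dg : C -> C) (a z w : C) :
  (forall u, half_plane u -> cderiv g u (dg u)) ->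
  half_plane z -> half_plane w ->
  exists t, 0 <= t <= 1 /\
    Re (a * (g w - g z)) = Re (a * (dg (z + RtoC t * (w - z))%C * (w - z))).
Proof.
  intros Hg Hz Hw.
  destruct (mean_value_curve (fun s => g (z + RtoC s * (w - z))%C)
    (fun s => dg (z + RtoC s * (w - z))%C * (w - z))%C a 0 1) as [t [Ht E]]; [lra | |].
  - intros t Ht; apply rderiv_segment, Hg, half_plane_convex; auto.
  - exists t; split; [exact Ht |].
    rewrite Rminus_0_r, Rmult_1_r in E. rewrite <- E.
    replace (z + RtoC 1 * (w - z))%C with w by ring.
    replace (z + RtoC 0 * (w - z))%C with z by ring. reflexivity.
Qed.

(** Pairing with the direction of the increment turns the mean value
    theorem into an inequality for complex values. *)
Lemma mean_value_curve_bound (g dg : R -> C) (s0 s1 M : R) :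
  s0 <= s1 -> (forall t, s0 <= t <= s1 -> rderiv g t (dg t)) ->
  (forall t, s0 <= t <= s1 -> Cmod (dg t) <= M) ->
  Cmod (g s1 - g s0) <= M * (s1 - s0).
Proof.
  intros Hs Hg HM.
  destruct (mean_value_curve g dg (Cconj (g s1 - g s0)) s0 s1 Hs Hg) as [t [Ht E]].
  rewrite Re_Cconj_mult_self in E.
  pose proof (Rle_trans _ _ _ (Rle_abs _) (re_le_Cmod
    (Cconj (g s1 - g s0) * dg t))) as B.
  rewrite Cmod_mult, Cmod_Cconj in B.
  specialize (HM t Ht).
  set (r := Cmod (g s1 - g s0)) in *.
  assert (Hr : 0 <= r) by apply Cmod_ge_0.
  pose proof (Cmod_ge_0 (dg t)).
  destruct (Req_dec r 0) as [-> | Hr0].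
  - apply Rmult_le_pos; lra.
  - apply Rmult_le_reg_l with r; [lra |].
    apply Rle_trans with (r * Cmod (dg t) * (s1 - s0)).
    + replace (r * r) with (r ^ 2) by ring. rewrite E.
      apply Rmult_le_compat_r; lra.
    + rewrite Rmult_assoc; apply Rmult_le_compat_l; [lra |].
      apply Rmult_le_compat_r; lra.
Qed.

Lemma mean_value_bound (g dg : C -> C) (z w : C) (M : R) :
  (forall u, half_plane u -> cderiv g u (dg u)) ->
  half_plane z -> half_plane w ->
  (forall t, 0 <= t <= 1 -> Cmod (dg (z + RtoC t * (w - z))%C) <= M) ->
  Cmod (g w - g z) <= M * Cmod (w - z).
Proof.
  intros Hg Hz Hw HM.
  pose proof (mean_value_curve_bound (fun s => g (z + RtoC s * (w - z))%C)
    (fun s => dg (z + RtoC s * (w - z))%C * (w - z))%C 0 1 (M * Cmod (w - z))) as B.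
  cbv beta in B. rewrite Rminus_0_r, Rmult_1_r in B.
  replace (z + RtoC 1 * (w - z))%C with w in B by ring.
  replace (z + RtoC 0 * (w - z))%C with z in B by ring.
  apply B; [lra | |].
  - intros t Ht; apply rderiv_segment, Hg, half_plane_convex; auto.
  - intros t Ht; rewrite Cmod_mult.
    apply Rmult_le_compat_r; [apply Cmod_ge_0 | auto].
Qed.

(** * The complex exponential *)

Definition cexp (z : C) : C := (exp (Re z) * cos (Im z), exp (Re z) * sin (Im z)).

Lemma cexp_plus (z w : C) : cexp (z + w) = (cexp z * cexp w)%C.
Proof.
  unfold cexp, Re, Im; simpl. rewrite exp_plus, cos_plus, sin_plus.
  unfold Cmult; simpl; f_equal; ring.
Qed.

Lemma Cmod_cexp (z : C) : Cmod (cexp z) = exp (Re z).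
Proof.
  unfold Cmod, cexp; simpl fst; simpl snd.
  replace ((exp (Re z) * cos (Im z)) ^ 2 + (exp (Re z) * sin (Im z)) ^ 2)
    with (exp (Re z) ^ 2 * ((sin (Im z))² + (cos (Im z))²)) by (unfold Rsqr; ring).
  rewrite sin2_cos2, Rmult_1_r, sqrt_pow2; [reflexivity |].
  apply Rlt_le, exp_pos.
Qed.

Lemma cexp_2PI : cexp (0, 2 * PI) = 1.
Proof.
  unfold cexp; simpl. rewrite exp_0, cos_2PI, sin_2PI. unfold RtoC; f_equal; ring.
Qed.

Lemma is_derive_eps (u : R -> R) (t l : R) :
  is_derive u t l -> forall eps, 0 < eps -> exists delta, 0 < delta /\
  forall s, Rabs (s - t) < delta -> Rabs (u s - u t - (s - t) * l) <= eps * Rabs (s - t).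
Proof.
  intros [_ H] eps He.
  destruct (H t (fun P HP => HP) (mkposreal eps He)) as [dl Hd].
  exists dl; split; [apply cond_pos | exact Hd].
Qed.

(** The estimate is made on the coordinates
    [exp x cos y - 1 - x = exp x (cos y - 1) + (exp x - 1 - x)] and
    [exp x sin y - y = exp x (sin y - y) + (exp x - 1) y]. *)
Lemma cderiv_cexp_0 : cderiv cexp 0 1.
Proof.
  intros eps He.
  (* The errors below add up to 9 eta |h|. *)
  set (eta := Rmin 1 (eps / 9)).
  assert (E1 : eta <= 1) by apply Rmin_l.
  assert (E2 : eta <= eps / 9) by apply Rmin_r.
  assert (E0 : 0 < eta) by (apply Rmin_pos; lra).
  destruct (is_derive_eps exp 0 _ (is_derive_exp 0) eta E0) as [d1 [Hd1 H1]].
  destruct (is_derive_eps cos 0 _ (is_derive_cos 0) eta E0) as [d2 [Hd2 H2]].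
  destruct (is_derive_eps sin 0 _ (is_derive_sin 0) eta E0) as [d3 [Hd3 H3]].
  rewrite exp_0 in H1. rewrite cos_0, sin_0 in H2, H3.
  exists (Rmin (Rmin d1 d2) (Rmin d3 eta)); split; [repeat apply Rmin_pos; lra |].
  intros h Hh.
  pose proof (Rmin_l (Rmin d1 d2) (Rmin d3 eta)); pose proof (Rmin_r (Rmin d1 d2) (Rmin d3 eta)).
  pose proof (Rmin_l d1 d2); pose proof (Rmin_r d1 d2).
  pose proof (Rmin_l d3 eta); pose proof (Rmin_r d3 eta).
  replace (h - 0)%C with h in * by ring.
  pose proof (re_le_Cmod h) as Rh; pose proof (im_le_Cmod h) as Ih.
  specialize (H1 (Re h)); specialize (H2 (Im h)); specialize (H3 (Im h)).
  rewrite !Rminus_0_r in H1, H2, H3.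
  specialize (H1 ltac:(lra)); specialize (H2 ltac:(lra)); specialize (H3 ltac:(lra)).
  eapply Rle_trans; [apply Cmod_re_im |].
  set (x := Re h) in *; set (y := Im h) in *.
  replace (Re (cexp h - cexp 0 - 1 * h)) with (exp x * (cos y - 1) + (exp x - 1 - x * 1)).
  2:{ unfold cexp, x, y, Re, Im; simpl; rewrite exp_0, cos_0; ring. }
  replace (Im (cexp h - cexp 0 - 1 * h)) with
    (exp x * (sin y - y) + ((exp x - 1 - x * 1) + x) * y).
  2:{ unfold cexp, x, y, Re, Im; simpl; rewrite exp_0, sin_0; ring. }
  replace (cos y - 1 - y * - 0) with (cos y - 1) in H2 by ring.
  replace (sin y - 0 - y * 1) with (sin y - y) in H3 by ring.
  assert (X3 : 0 < exp x <= 3).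
  { split; [apply exp_pos |]. apply Rle_trans with (exp 1); [| apply exp_le_3].
    destruct (Rle_lt_or_eq_dec x 1) as [Hl | ->]; [| | lra].
    - pose proof (Rle_abs x); lra.
    - left; apply exp_increasing; lra. }
  set (p := exp x - 1 - x * 1) in *.
  pose proof (Rabs_pos x); pose proof (Rabs_pos y).
  assert (A1 : Rabs (exp x * (cos y - 1)) <= 3 * (eta * Rabs y)).
  { rewrite Rabs_mult, (Rabs_pos_eq (exp x)) by lra.
    apply Rmult_le_compat; try lra; apply Rabs_pos. }
  assert (A2 : Rabs (exp x * (sin y - y)) <= 3 * (eta * Rabs y)).
  { rewrite Rabs_mult, (Rabs_pos_eq (exp x)) by lra.
    apply Rmult_le_compat; try lra; apply Rabs_pos. }
  assert (A3 : Rabs ((p + x) * y) <= 2 * eta * Rabs y).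
  { rewrite Rabs_mult; apply Rmult_le_compat_r; [lra |].
    eapply Rle_trans; [apply Rabs_triang |]. nra. }
  pose proof (Rabs_triang (exp x * (cos y - 1)) p).
  pose proof (Rabs_triang (exp x * (sin y - y)) ((p + x) * y)).
  apply Rle_trans with (9 * eta * Cmod h); [nra |].
  apply Rmult_le_compat_r; [apply Cmod_ge_0 | lra].
Qed.

Lemma cderiv_cexp (z : C) : cderiv cexp z (cexp z).
Proof.
  apply (deriv_along_ext _ (fun w => cexp z * cexp ((- z) + 1 * w))%C).
  { intros w; rewrite <- cexp_plus; f_equal; ring. }
  apply (cderiv_ext_val _ _ (cexp z * (1 * 1)))%C.
  { ring. }
  apply deriv_along_scal.
  apply (deriv_along_comp _ (fun w => - z + 1 * w)%C cexp z); [apply cderiv_affine |].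
  replace (- z + 1 * z)%C with (RtoC 0) by ring. apply cderiv_cexp_0.
Qed.

(** * Holomorphic functions with nonnegative real part *)

Lemma cderiv_zero_constant (g : C -> C) (z w : C) :
  (forall u, half_plane u -> cderiv g u 0) -> half_plane z -> half_plane w -> g z = g w.
Proof.
  intros Hg Hz Hw.
  assert (B : Cmod (g w - g z) <= 0 * Cmod (w - z)).
  { apply (mean_value_bound g (fun _ => RtoC 0)); auto.
    intros; rewrite Cmod_0; lra. }
  rewrite Rmult_0_l in B.
  assert (E : (g w - g z)%C = 0) by (apply Cmod_eq_0, Rle_antisym; [exact B | apply Cmod_ge_0]).
  replace (g w) with (g z + (g w - g z))%C by ring. rewrite E; ring.
Qed.

(** A minimum principle for Re K on the disc, at a removable singularity.
    The function [K (exp (- w))] has a primitive [P] on the half-plane and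
    period [2 pi i], so the increment of [P] over a period is a constant. On
    the line [Re w = - ln r] its imaginary part is nonnegative, being [2 pi]
    times a value of [Re K] on the circle of radius [r]; far to the right it is
    [2 pi] times a value of [Re K] close to [Re L]. *)
Lemma Re_limit_nonneg (K : C -> C) (L : C) (r : R) :
  0 < r < 1 ->
  (forall u, 0 < Cmod u < 1 -> differentiable_at K u) ->
  (forall eps, 0 < eps -> exists delta, 0 < delta /\
     forall u, 0 < Cmod u < delta -> Cmod (K u - L) < eps) ->
  (forall u, Cmod u = r -> 0 <= Re (K u)) ->
  0 <= Re L.
Proof.
  intros Hr HK HL Hpos.
  set (k := fun w => K (cexp (-(1) * w)%C)).
  assert (Hk : holomorphic k).
  { intros w Hw. destruct (HK (cexp (-(1) * w)%C)) as [d Hd].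
    - rewrite Cmod_cexp; split; [apply exp_pos |].
      apply Rlt_le_trans with (exp 0); [| rewrite exp_0; lra].
      apply exp_increasing; unfold half_plane, Re in *; simpl; lra.
    - eexists. apply (deriv_along_comp _ (fun w => cexp (-(1) * w)%C) K w); [| exact Hd].
      apply (deriv_along_comp _ (fun w => -(1) * w)%C cexp w); [| apply cderiv_cexp].
      apply (deriv_along_ext _ (fun w => 0 + -(1) * w)%C); [intros; ring |].
      apply cderiv_affine. }
  destruct (primitive_exists k Hk) as [P HP].
  set (tau := (0, 2 * PI) : C).
  assert (Htau : forall w, half_plane w -> half_plane (w + tau)%C).
  { unfold half_plane, Re; intros w Hw; simpl; lra. }
  assert (Hper : forall w, k (w + tau)%C = k w).
  { intros w; unfold k. replace (-(1) * w)%C with (-(1) * (w + tau) + tau)%C at 1 by ring.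
    rewrite cexp_plus. change (cexp tau) with (cexp (0, 2 * PI)).
    rewrite cexp_2PI; f_equal; ring. }
  set (D := fun w => (P (w + tau) + -(1) * P w)%C).
  assert (HD : forall w, half_plane w -> cderiv D w 0).
  { intros w Hw.
    apply (cderiv_ext_val _ _ (k (w + tau) * 1 + -(1) * k w))%C.
    { rewrite Hper; ring. }
    apply deriv_along_plus.
    - apply (deriv_along_comp _ (fun w => w + tau)%C P w).
      + apply (deriv_along_ext _ (fun w => tau + 1 * w)%C); [intros; ring |].
        apply cderiv_affine.
      + apply HP; auto.
    - apply deriv_along_scal, HP; auto. }
  (* The mean of Re K over a circle is one of its values on the circle. *)
  assert (Hval : forall x, 0 < x -> exists u, Cmod u = exp (- x) /\
    Im (D (RtoC x)) = 2 * PI * Re (K u)).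
  { intros x Hx.
    assert (Hx' : half_plane (RtoC x)) by (unfold half_plane; simpl; lra).
    destruct (mean_value_segment P k (- Ci)%C (RtoC x) (RtoC x + tau)%C HP) as [t [Ht E]]; auto.
    exists (cexp (-(1) * (RtoC x + RtoC t * (RtoC x + tau - RtoC x)))%C); split.
    - rewrite Cmod_cexp; f_equal; simpl; ring.
    - fold (k (RtoC x + RtoC t * (RtoC x + tau - RtoC x))%C).
      transitivity (Re (- Ci * (P (RtoC x + tau)%C - P (RtoC x)))).
      + unfold D, Re, Im; simpl; ring.
      + rewrite E. unfold Re; simpl; ring. }
  apply Rnot_lt_le; intros Hneg.
  destruct (HL (- Re L)) as [dl [Hd HLd]]; [lra |].
  assert (HPI := PI_RGT_0).
  assert (Hlr : 0 < - ln r) by (pose proof (ln_increasing r 1); rewrite ln_1 in *; lra).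
  destruct (Hval (- ln r) Hlr) as [u [Hu1 Hu2]].
  rewrite Ropp_involutive, exp_ln in Hu1 by lra.
  specialize (Hpos u Hu1).
  set (x := Rmax 1 (1 - ln dl)).
  assert (Hx1 : 1 <= x) by apply Rmax_l.
  assert (Hx2 : 1 - ln dl <= x) by apply Rmax_r.
  destruct (Hval x) as [v [Hv1 Hv2]]; [lra |].
  assert (Hc : D (RtoC (- ln r)) = D (RtoC x)).
  { apply cderiv_zero_constant; auto; unfold half_plane; simpl; lra. }
  assert (Hvd : Cmod (K v - L) < - Re L).
  { apply HLd; rewrite Hv1; split; [apply exp_pos |].
    rewrite <- (exp_ln dl Hd); apply exp_increasing; lra. }
  pose proof (Rle_trans _ _ _ (Rle_abs _) (re_le_Cmod (K v - L))) as B.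
  change (Re (K v - L)) with (Re (K v) - Re L) in B.
  rewrite Hc, Hv2 in Hu2. nra.
Qed.

Lemma Re_cayley (u : C) :
  Cmod u < 1 -> 0 < Re (2 / (1 - u) - 1).
Proof.
  intros Hu.
  assert (S : Re u ^ 2 + Im u ^ 2 < 1).
  { rewrite <- Cmod_sq. pose proof (Cmod_ge_0 u); nra. }
  destruct u as [x y]; unfold Re, Im in S; simpl in S.
  assert (P : 0 < (1 - x) ^ 2 + y ^ 2).
  { assert (x < 1) by nra. pose proof (pow2_ge_0 y); nra. }
  replace (Re _) with ((1 - (x * x + y * y)) / ((1 - x) ^ 2 + y ^ 2)).
  - apply Rdiv_lt_0_compat; nra.
  - unfold Re; simpl; field. nra.
Qed.

(** On the circle [|u| = r] put [q = a u / r], of modulus 1. The real part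
    is [2 (1 + Re q) Re G]: the terms in [G0] combine into
    [q conj G0 - conj (q conj G0)], which is imaginary. *)
Lemma poisson_kernel_Re_nonneg (G G0 a u : C) (r : R) :
  0 < r -> Cmod a = 1 -> Cmod u = r -> 0 <= Re G ->
  0 <= Re (2 * G + a / RtoC r * u * (G + Cconj G0) + Cconj a * RtoC r / u * (G - G0)).
Proof.
  intros Hr Ha Hu HG.
  set (q := (a * u / RtoC r)%C).
  assert (Hr0 : RtoC r <> 0) by (intros E; apply RtoC_inj in E; lra).
  assert (Hu0 : u <> 0) by (intros ->; rewrite Cmod_0 in Hu; lra).
  assert (Hq : Cmod q = 1).
  { unfold q; rewrite Cmod_div, Cmod_mult, Ha, Hu, Cmod_R, Rabs_pos_eq by (auto; lra).
    field; lra. }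
  assert (Hcq : (Cconj a * RtoC r / u)%C = Cconj q).
  { assert (Huu : (Cconj u * u = RtoC r * RtoC r)%C).
    { replace (Cconj u * u)%C with (RtoC (Re u ^ 2 + Im u ^ 2)).
      - rewrite <- Cmod_sq, Hu, <- RtoC_mult; f_equal; ring.
      - unfold RtoC, Re, Im; destruct u; unfold Cmult, Cconj; simpl; f_equal; ring. }
    unfold q. replace (Cconj (a * u / RtoC r)) with (Cconj a * Cconj u / RtoC r)%C.
    - assert (Hcu : Cconj u = (RtoC r * RtoC r / u)%C) by (rewrite <- Huu; field; auto).
      rewrite Hcu; field; auto.
    - unfold Cdiv. rewrite !Cmult_conj, Cinv_conj by auto.
      replace (Cconj (RtoC r)) with (RtoC r)
        by (unfold Cconj, RtoC; simpl; f_equal; ring). reflexivity. }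
  rewrite Hcq. replace (a / RtoC r * u)%C with q by (unfold q; field; auto).
  pose proof (re_le_Cmod q) as B. rewrite Hq in B. apply Rabs_le_between in B.
  replace (Re _) with (2 * (1 + Re q) * Re G) by (unfold Re; simpl; ring).
  apply Rmult_le_pos; lra.
Qed.

(** The kernel of [poisson_kernel_Re_nonneg], as a function of [u] with
    [G = G u] and [G0 = G 0], has nonnegative real part on the circle and the
    limit [2 G0 + r conj a G' 0] at 0. The unimodular [a] is chosen to make the
    second term [- r |G' 0|]. *)
Lemma caratheodory_radius (G : C -> C) (e : C) (r : R) :
  0 < r < 1 ->
  (forall u, Cmod u < 1 -> differentiable_at G u) ->
  (forall u, Cmod u < 1 -> 0 <= Re (G u)) ->
  cderiv G 0 e -> r * Cmod e <= 2 * Re (G 0).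
Proof.
  intros Hr HG Hpos He.
  set (G0 := G (RtoC 0)) in *.
  assert (HG0 : 0 <= Re G0) by (apply Hpos; rewrite Cmod_0; lra).
  destruct (Req_dec (Cmod e) 0) as [-> | Hn]; [lra |].
  assert (He0 : 0 < Cmod e) by (pose proof (Cmod_ge_0 e); lra).
  assert (Hr0 : RtoC r <> 0) by (apply neq_0_of_Cmod_pos; rewrite Cmod_R, Rabs_pos_eq; lra).
  assert (HE0 : RtoC (Cmod e) <> 0)
    by (apply neq_0_of_Cmod_pos; rewrite Cmod_R, Rabs_pos_eq; lra).
  set (a := (RtoC (-1 / Cmod e) * e)%C).
  assert (Ha : Cmod a = 1).
  { unfold a; rewrite Cmod_mult, Cmod_R, Rabs_left.
    - field; lra.
    - pose proof (Rdiv_lt_0_compat 1 (Cmod e)). lra. }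
  set (L := (2 * G0 + Cconj a * RtoC r * e)%C).
  assert (EL : Re L = 2 * Re G0 - r * Cmod e).
  { unfold L. replace (Re _) with (2 * Re G0 - r / Cmod e * Re (Cconj e * e)).
    - rewrite Re_Cconj_mult_self; field; lra.
    - unfold a, Re; simpl; field; lra. }
  cut (0 <= Re L); [lra |].
  apply (Re_limit_nonneg (fun u => 2 * G u + a / RtoC r * u * (G u + Cconj G0)
    + Cconj a * RtoC r * / u * (G u + -(1) * G0))%C L r Hr).
  - intros u Hu.
    assert (Hu0 : u <> 0) by (apply neq_0_of_Cmod_pos; lra).
    pose proof (HG u ltac:(lra)) as D.
    repeat (apply differentiable_plus || apply differentiable_mult ||
      apply differentiable_const || apply differentiable_id || exact D ||
      (apply (differentiable_inv (fun w => w)); [apply differentiable_id | exact Hu0])).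
  - intros eps Heps.
    destruct (He (eps / 4)) as [d1 [Hd1 H1]]; [lra |].
    set (b := eps / 4 + Cmod e).
    (* Near 0 the kernel is within c |u| + eps / 4 of its limit. *)
    set (c := 2 * b + (b + 2 * Cmod G0) / r).
    pose proof (Cmod_ge_0 G0) as PG0.
    assert (Hb : 0 < b) by (unfold b; lra).
    assert (Hc : 0 < c).
    { unfold c. assert (0 < (b + 2 * Cmod G0) / r) by (apply Rdiv_lt_0_compat; lra). lra. }
    exists (Rmin (Rmin d1 1) (eps / 2 / (c + 1))); split.
    { repeat apply Rmin_pos; try lra. apply Rdiv_lt_0_compat; lra. }
    intros u [Hu Hud].
    pose proof (Rmin_l (Rmin d1 1) (eps / 2 / (c + 1))).
    pose proof (Rmin_r (Rmin d1 1) (eps / 2 / (c + 1))) as Hu3.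
    pose proof (Rmin_l d1 1); pose proof (Rmin_r d1 1).
    assert (Hu4 : Cmod u * (c + 1) < eps / 2) by (apply Rlt_div_r; lra).
    assert (Hu0 : u <> 0) by (apply neq_0_of_Cmod_pos; lra).
    assert (E0 : (u - 0)%C = u) by ring.
    specialize (H1 u); simpl in H1; rewrite E0 in H1; fold G0 in H1.
    specialize (H1 ltac:(lra)).
    set (w := (G u - G0)%C) in *.
    assert (Hw : Cmod w <= b * Cmod u).
    { replace w with ((w - e * u) + e * u)%C by ring.
      eapply Rle_trans; [apply Cmod_triangle |]; rewrite Cmod_mult; unfold b; lra. }
    assert (Hq : Cmod (w / u - e) <= eps / 4).
    { replace (w / u - e)%C with ((w - e * u) / u)%C by (field; auto).
      rewrite Cmod_div by auto. apply Rle_div_l; lra. }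
    replace (2 * G u + a / RtoC r * u * (G u + Cconj G0) +
      Cconj a * RtoC r * / u * (G u + -(1) * G0) - L)%C
      with ((2 * w + a / RtoC r * u * (w + (G0 + Cconj G0))) + Cconj a * RtoC r * (w / u - e))%C
      by (unfold L, w; field; auto).
    eapply Rle_lt_trans; [apply Cmod_triangle |].
    apply Rle_lt_trans with (c * Cmod u + eps / 4); [| lra].
    apply Rplus_le_compat.
    + eapply Rle_trans; [apply Cmod_triangle |].
      unfold Cdiv; rewrite !Cmod_mult, Cmod_inv, !Cmod_R, Ha by auto.
      rewrite (Rabs_pos_eq 2), (Rabs_pos_eq r) by lra.
      assert (Hs : Cmod (w + (G0 + Cconj G0)) <= b + 2 * Cmod G0).
      { eapply Rle_trans; [apply Cmod_triangle |].
        assert (Cmod w <= b) by nra.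
        pose proof (Cmod_triangle G0 (Cconj G0)) as T. rewrite Cmod_Cconj in T. lra. }
      unfold c. apply Rle_trans with (2 * (b * Cmod u) + Cmod u * ((b + 2 * Cmod G0) / r)); [| lra].
      apply Rplus_le_compat; [lra |].
      replace (1 * / r * Cmod u * Cmod (w + (G0 + Cconj G0)))
        with (Cmod u * (Cmod (w + (G0 + Cconj G0)) / r)) by (field; lra).
      apply Rmult_le_compat_l; [lra |].
      apply Rmult_le_compat_r; [left; apply Rinv_0_lt_compat; lra | exact Hs].
    + rewrite !Cmod_mult, Cmod_Cconj, Ha, Cmod_R, Rabs_pos_eq by lra.
      pose proof (Cmod_ge_0 (w / u - e)). nra.
  - intros u Hu.
    replace (Cconj a * RtoC r * / u * (G u + - (1) * G0))%C
      with (Cconj a * RtoC r / u * (G u - G0))%C by (unfold Cdiv; ring).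
    apply poisson_kernel_Re_nonneg; auto; [lra |]. apply Hpos; lra.
Qed.

Lemma caratheodory (G : C -> C) (e : C) :
  (forall u, Cmod u < 1 -> differentiable_at G u) ->
  (forall u, Cmod u < 1 -> 0 <= Re (G u)) ->
  cderiv G 0 e -> Cmod e <= 2 * Re (G 0).
Proof.
  intros HG Hpos He.
  assert (HG0 : 0 <= Re (G 0)) by (apply Hpos; rewrite Cmod_0; lra).
  apply Rnot_lt_le; intros Hlt.
  set (r := (2 * Re (G 0) / Cmod e + 1) / 2).
  assert (Hq : 0 <= 2 * Re (G 0) / Cmod e < 1).
  { split; [apply Rle_div_r; lra | apply Rlt_div_l; lra]. }
  assert (Hr : 0 < r < 1) by (unfold r; lra).
  pose proof (caratheodory_radius G e r Hr HG Hpos He) as B.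
  assert (E : r * Cmod e = Re (G 0) + Cmod e / 2) by (unfold r; field; lra).
  lra.
Qed.

(** Caratheodory's bound after composition with the Cayley map of the disc
    onto the half-plane, centred at [z], whose derivative at 0 is [2 Re z]. The
    sharp constant 1 is what excludes blow-up in [no_blow_up]. *)
Lemma schwarz_pick (g : C -> C) (z d : C) :
  holomorphic g -> (forall u, half_plane u -> 0 <= Re (g u)) ->
  half_plane z -> cderiv g z d -> Cmod d * Re z <= Re (g z).
Proof.
  intros Hg Hpos Hz Hd.
  set (x := Re z); set (y := Im z).
  set (m := fun u : C => (Ci * RtoC y + RtoC x * (2 * / (1 + -(1) * u) + -(1)))%C).
  assert (Hm : forall u, Cmod u < 1 -> half_plane (m u)).
  { intros u Hu; unfold half_plane, m.
    replace (Re _) with (x * Re (2 / (1 - u) - 1)).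
    - apply Rmult_lt_0_compat; [exact Hz | apply Re_cayley, Hu].
    - replace (2 * / (1 + -(1) * u) + -(1))%C with (2 / (1 - u) - 1)%C.
      + set (t := (2 / (1 - u) - 1)%C); unfold Re; simpl; ring.
      + replace (1 + -(1) * u)%C with (1 - u)%C by ring; unfold Cdiv; ring. }
  assert (Hn : forall u, Cmod u < 1 -> (1 + -(1) * u)%C <> 0).
  { intros u Hu E. assert (Eu : u = 1) by (replace u with (1 - (1 + -(1) * u))%C by ring; rewrite E; ring).
    rewrite Eu, Cmod_1 in Hu; lra. }
  assert (Dm : forall u, Cmod u < 1 -> cderiv m u (0 + RtoC x * (2 * (- / ((1 + -(1) * u) * (1 + -(1) * u)) * -(1)) + 0))%C).
  { intros u Hu; apply deriv_along_plus; [apply deriv_along_const |].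
    apply deriv_along_scal, deriv_along_plus; [| apply deriv_along_const].
    apply deriv_along_scal.
    apply (deriv_along_comp _ (fun u => 1 + -(1) * u)%C (fun w => / w)%C u).
    - apply cderiv_affine.
    - apply cderiv_inv, Hn, Hu. }
  assert (Em : m (RtoC 0) = z).
  { unfold m; replace (1 + -(1) * 0)%C with (RtoC 1) by ring.
    transitivity (Ci * RtoC y + RtoC x)%C; [field |].
    apply injective_projections; unfold x, y, Re, Im; simpl; ring. }
  assert (H01 : Cmod 0 < 1) by (rewrite Cmod_0; lra).
  pose proof (caratheodory (fun u => g (m u)) (d * (2 * RtoC x))) as B.
  cbv beta in B; rewrite Em in B.
  rewrite !Cmod_mult, !Cmod_R, (Rabs_pos_eq 2), (Rabs_pos_eq x) in B
    by (unfold half_plane in Hz; unfold x; lra).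
  cut (Cmod d * (2 * x) <= 2 * Re (g z)); [lra |]. apply B.
  - intros u Hu; apply (differentiable_comp m g).
    + eexists; apply Dm, Hu.
    + apply Hg, Hm, Hu.
  - intros u Hu; apply Hpos, Hm, Hu.
  - apply (deriv_along_comp _ m g).
    + eapply cderiv_ext_val; [| apply Dm, H01].
      replace (1 + -(1) * 0)%C with (RtoC 1) by ring. field.
    + rewrite Em; exact Hd.
Qed.

(** * Harnack inequality and equicontinuity *)

Lemma gronwall (u du : R -> R) (M T : R) :
  0 <= T -> (forall t, 0 <= t <= T -> is_derive u t (du t)) ->
  (forall t, 0 <= t <= T -> du t <= M * u t) ->
  u T <= u 0 * exp (M * T).
Proof.
  intros HT Hu Hle.
  assert (D : forall t, 0 <= t <= T ->
    is_derive (fun t => u t * exp (- M * t)) t ((du t - M * u t) * exp (- M * t))).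
  { intros t Ht; specialize (Hu t Ht).
    auto_derive; [exists (du t); exact Hu |].
    rewrite (is_derive_unique (fun x : R => u x) t (du t) Hu); ring. }
  destruct (MVT_gen (fun t => u t * exp (- M * t)) 0 T
    (fun t => (du t - M * u t) * exp (- M * t))) as [t [Ht E]];
    rewrite ?Rmin_left, ?Rmax_right in * by lra.
  - intros t Ht; apply D; lra.
  - intros t Ht; exact (is_derive_continuity _ _ _ (D t Ht)).
  - specialize (Hle t Ht).
    assert (N : (du t - M * u t) * exp (- M * t) * (T - 0) <= 0).
    { pose proof (exp_pos (- M * t)).
      assert (0 <= exp (- M * t) * T) by (apply Rmult_le_pos; lra). nra. }
    rewrite <- E, Rmult_0_r, exp_0 in N.
    assert (N' : u T * exp (- M * T) <= u 0) by lra.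
    apply (Rmult_le_compat_r (exp (M * T))) in N'; [| left; apply exp_pos].
    rewrite Rmult_assoc, <- exp_plus in N'.
    replace (- M * T + M * T) with 0 in N' by ring. rewrite exp_0 in N'; lra.
Qed.

(** By the Schwarz-Pick inequality the logarithmic derivative of [Re g]
    along the segment is at most [|z - v| / m]. *)
Lemma harnack_segment (g : C -> C) (v z : C) (m : R) :
  holomorphic g -> (forall u, half_plane u -> 0 <= Re (g u)) ->
  0 < m -> m <= Re v -> m <= Re z ->
  Re (g z) <= Re (g v) * exp (Cmod (z - v) / m).
Proof.
  intros Hg Hpos Hm Hv Hz.
  assert (Hseg : forall t, 0 <= t <= 1 -> m <= Re (v + RtoC t * (z - v))%C).
  { intros t Ht. replace (Re (v + RtoC t * (z - v))%C) with ((1 - t) * Re v + t * Re z)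
      by (unfold Re; simpl; ring). nra. }
  destruct (holomorphic_has_derivative g Hg) as [dg Hdg].
  assert (HP : forall t, 0 <= t <= 1 -> half_plane (v + RtoC t * (z - v))%C)
    by (intros t Ht; specialize (Hseg t Ht); unfold half_plane; lra).
  pose proof (gronwall (fun t => Re (1 * g (v + RtoC t * (z - v))%C))
    (fun t => Re (1 * (dg (v + RtoC t * (z - v))%C * (z - v))))
    (Cmod (z - v) / m) 1) as B.
  cbv beta in B.
  replace (v + RtoC 1 * (z - v))%C with z in B by ring.
  replace (v + RtoC 0 * (z - v))%C with v in B by ring.
  rewrite !Cmult_1_l, Rmult_1_r in B. apply B; [lra | |].
  - intros t Ht; apply (rderiv_is_derive (fun s => g (v + RtoC s * (z - v))%C)),
      rderiv_segment, Hdg, HP, Ht.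
  - intros t Ht; rewrite !Cmult_1_l.
    eapply Rle_trans; [apply Rle_abs |].
    eapply Rle_trans; [apply re_le_Cmod |]. rewrite Cmod_mult.
    pose proof (schwarz_pick g _ _ Hg Hpos (HP t Ht) (Hdg _ (HP t Ht))) as S.
    specialize (Hseg t Ht).
    set (u := (v + RtoC t * (z - v))%C) in *.
    pose proof (Cmod_ge_0 (dg u)); pose proof (Cmod_ge_0 (z - v)).
    replace (Cmod (z - v) / m * Re (g u)) with (Re (g u) / m * Cmod (z - v)) by (field; lra).
    apply Rmult_le_compat_r; [lra |].
    apply Rle_div_r; [lra |]. nra.
Qed.

(** Equicontinuity of the holomorphic self-maps of the half-plane: the bound
    depends on [g] only through its value at one endpoint. *)
Lemma lipschitz_segment (g : C -> C) (v z : C) (m : R) :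
  holomorphic g -> (forall u, half_plane u -> 0 <= Re (g u)) ->
  0 < m -> m <= Re v -> m <= Re z ->
  Cmod (g z - g v) <= Re (g v) * exp (Cmod (z - v) / m) / m * Cmod (z - v).
Proof.
  intros Hg Hpos Hm Hv Hz.
  destruct (holomorphic_has_derivative g Hg) as [dg Hdg].
  apply (mean_value_bound g dg); auto; try (unfold half_plane; lra).
  intros t Ht.
  assert (Hseg : m <= Re (v + RtoC t * (z - v))%C).
  { replace (Re (v + RtoC t * (z - v))%C) with ((1 - t) * Re v + t * Re z)
      by (unfold Re; simpl; ring). nra. }
  set (u := (v + RtoC t * (z - v))%C) in *.
  assert (Hu : half_plane u) by (unfold half_plane; lra).
  pose proof (schwarz_pick g _ _ Hg Hpos Hu (Hdg u Hu)) as S.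
  pose proof (harnack_segment g v u m Hg Hpos Hm Hv Hseg) as N.
  assert (Huv : Cmod (u - v) <= Cmod (z - v)).
  { replace (u - v)%C with (RtoC t * (z - v))%C by (unfold u; ring).
    rewrite Cmod_mult, Cmod_R, Rabs_pos_eq by lra.
    pose proof (Cmod_ge_0 (z - v)); nra. }
  assert (Hexp : exp (Cmod (u - v) / m) <= exp (Cmod (z - v) / m)).
  { destruct Huv as [Huv | ->]; [| lra].
    left; apply exp_increasing, Rmult_lt_compat_r; [apply Rinv_0_lt_compat |]; auto. }
  pose proof (Hpos v ltac:(unfold half_plane; lra)) as P.
  pose proof (Cmod_ge_0 (dg u)).
  apply Rle_div_r; [lra |]. nra.
Qed.

Lemma Re_zero_of_zero (g : C -> C) (z0 z : C) :
  holomorphic g -> (forall u, half_plane u -> 0 <= Re (g u)) ->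
  half_plane z0 -> g z0 = RtoC 0 -> half_plane z -> Re (g z) = 0.
Proof.
  intros Hg Hpos H0 E Hz.
  pose proof (harnack_segment g z0 z (Rmin (Re z0) (Re z)) Hg Hpos
    (Rmin_pos _ _ H0 Hz) (Rmin_l _ _) (Rmin_r _ _)) as B.
  rewrite E in B; simpl in B; rewrite Rmult_0_l in B.
  specialize (Hpos z Hz); lra.
Qed.

(** * Inverting a primitive whose derivative has positive real part *)

Lemma Re_inv_pos (z : C) : 0 < Re z -> 0 < Re (/ z).
Proof.
  intros Hz. destruct z as [x y]; unfold Re in *; simpl in *.
  apply Rdiv_lt_0_compat; nra.
Qed.

(** Completeness of C, in a form that serves both for a sequence and for a
    Lipschitz curve on a half-open interval. The factor 2 pays for intersecting
    the shadows of the discs on the two axes. *)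
Lemma discs_meet {I : Type} (i0 : I) (u : I -> C) (e : I -> R) :
  (forall i k, Cmod (u i - u k) <= e i + e k) ->
  exists l, forall i, Cmod (l - u i) <= 2 * e i.
Proof.
  intros H.
  destruct (intervals_meet i0 (fun i => Re (u i) - e i) (fun i => Re (u i) + e i)) as [x Hx].
  { intros i k. specialize (H i k). pose proof (re_le_Cmod (u i - u k)) as B.
    change (Re (u i - u k)) with (Re (u i) - Re (u k)) in B.
    apply Rabs_le_between in B; lra. }
  destruct (intervals_meet i0 (fun i => Im (u i) - e i) (fun i => Im (u i) + e i)) as [y Hy].
  { intros i k. specialize (H i k). pose proof (im_le_Cmod (u i - u k)) as B.
    change (Im (u i - u k)) with (Im (u i) - Im (u k)) in B.
    apply Rabs_le_between in B; lra. }
  exists (x, y); intros i. specialize (Hx i); specialize (Hy i).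
  eapply Rle_trans; [apply Cmod_re_im |].
  change (Re ((x, y) - u i)%C) with (x - Re (u i)).
  change (Im ((x, y) - u i)%C) with (y - Im (u i)).
  assert (Rabs (x - Re (u i)) <= e i) by (apply Rabs_le; lra).
  assert (Rabs (y - Im (u i)) <= e i) by (apply Rabs_le; lra). lra.
Qed.

Lemma half_contraction_fixed_point (T : C -> C) (w0 : C) (r : R) :
  0 < r ->
  (forall u v, Cmod (u - w0) <= r -> Cmod (v - w0) <= r ->
     Cmod (T u - T v) <= 1 / 2 * Cmod (u - v)) ->
  Cmod (T w0 - w0) <= r / 4 ->
  exists w, Cmod (w - w0) <= r /\ T w = w.
Proof.
  intros Hr HT H0.
  set (u := fix u (n : nat) : C := match n with O => w0 | S k => T (u k) end).
  assert (Hself : Cmod (w0 - w0) <= r)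
    by (replace (w0 - w0)%C with (RtoC 0) by ring; rewrite Cmod_0; lra).
  assert (Hball : forall n, Cmod (u n - w0) <= r / 2).
  { induction n as [| n IH]; simpl.
    - replace (w0 - w0)%C with (RtoC 0) by ring; rewrite Cmod_0; lra.
    - pose proof (Cmod_triangle_sub (T (u n)) (T w0) w0).
      pose proof (HT (u n) w0 ltac:(lra) Hself). lra. }
  assert (Hpw : forall n, 0 < (1 / 2) ^ n) by (intros; apply pow_lt; lra).
  assert (Hgeo : forall n p, Cmod (u n - u (n + p)%nat) <= (1 / 2) ^ n * (r / 2)).
  { induction n as [| n IH]; intros p; simpl.
    - rewrite Cmod_sub_comm, Rmult_1_l; apply Hball.
    - pose proof (HT (u n) (u (n + p)%nat)) as B.
      pose proof (Hball n); pose proof (Hball (n + p)%nat).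
      specialize (B ltac:(lra) ltac:(lra)). specialize (IH p). lra. }
  destruct (discs_meet O u (fun n => (1 / 2) ^ n * (r / 2))) as [l Hl].
  { assert (G : forall n m, (n <= m)%nat ->
      Cmod (u n - u m) <= (1 / 2) ^ n * (r / 2) + (1 / 2) ^ m * (r / 2)).
    { intros n m Hnm. replace m with (n + (m - n))%nat at 1 by lia.
      specialize (Hgeo n (m - n)%nat). specialize (Hpw m). nra. }
    intros n m; destruct (Nat.le_ge_cases n m) as [Hc | Hc].
    - apply G, Hc.
    - rewrite Cmod_sub_comm, Rplus_comm; apply G, Hc. }
  assert (Hlr : Cmod (l - w0) <= r).
  { specialize (Hl O); simpl in Hl. lra. }
  exists l; split; [exact Hlr |].
  assert (E : forall n, Cmod (T l - l) <= (1 / 2) ^ n * (2 * r)).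
  { intros n. pose proof (Hl n) as H1; pose proof (Hl (S n)) as H2.
    pose proof (Cmod_triangle_sub (T l) (u (S n)) l) as H3.
    rewrite (Cmod_sub_comm (u (S n)) l) in H3.
    pose proof (Hball n) as Hb.
    pose proof (HT l (u n) Hlr ltac:(lra)) as H4.
    change (T (u n)) with (u (S n)) in H4.
    replace ((1 / 2) ^ S n) with ((1 / 2) ^ n / 2) in H2 by (simpl; field).
    specialize (Hpw n). nra. }
  assert (Z : Cmod (T l - l) <= 0).
  { apply le_epsilon; intros eps He. rewrite Rplus_0_l.
    destruct (pow_lt_1_zero (1 / 2)) with (y := eps / (2 * r)) as [n Hn];
      [rewrite Rabs_pos_eq; lra | apply Rdiv_lt_0_compat; lra |].
    specialize (Hn n (Nat.le_refl n)). rewrite Rabs_pos_eq in Hn by (left; apply Hpw).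
    apply Rlt_div_r in Hn; [| lra]. specialize (E n); lra. }
  assert (Z0 : (T l - l)%C = 0) by (apply Cmod_eq_0, Rle_antisym; [exact Z | apply Cmod_ge_0]).
  replace (T l) with ((T l - l) + l)%C by ring. rewrite Z0; ring.
Qed.

Section Inverse.
Context (g H : C -> C).
Hypothesis g_hol : holomorphic g.
Hypothesis g_pos : forall z, half_plane z -> 0 < Re (g z).
Hypothesis H_deriv : forall z, half_plane z -> cderiv H z (/ g z).

Lemma reciprocal_continuous (z : C) : half_plane z -> forall eps, 0 < eps ->
  exists delta, 0 < delta /\ forall w, Cmod (w - z) < delta ->
    half_plane w /\ Cmod (/ g w - / g z) < eps.
Proof.
  intros Hz eps He.
  destruct (differentiable_inv g z (g_hol z Hz) (neq_0_of_Re_pos _ (g_pos z Hz))) as [d Hd].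
  destruct (deriv_along_continuous _ _ _ _ Hd eps He) as [dl [Hdl Hc]].
  exists (Rmin dl (Re z)); split; [apply Rmin_pos; auto |].
  intros w Hw; split.
  - pose proof (Rlt_le_trans _ _ _ Hw (Rmin_r _ _)) as B.
    pose proof (re_le_Cmod (w - z)) as A.
    change (Re (w - z)) with (Re w - Re z) in A. apply Rabs_le_between in A.
    unfold half_plane; lra.
  - apply Hc, (Rlt_le_trans _ _ _ Hw (Rmin_l _ _)).
Qed.

(** Convexity of the half-plane and [Re H' > 0] (Noshiro-Warschawski) *)
Lemma primitive_Re_increment_pos (z w : C) : half_plane z -> half_plane w -> z <> w ->
  0 < Re (Cconj (w - z) * (H w - H z)).
Proof.
  intros Hz Hw Hne.
  destruct (mean_value_segment H (fun u => / g u)%C (Cconj (w - z)) z w H_deriv Hz Hw)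
    as [t [Ht E]].
  rewrite E. set (u := (z + RtoC t * (w - z))%C).
  replace (Re _) with (Re (/ g u) * Re (Cconj (w - z) * (w - z)))
    by (unfold Re; simpl; ring).
  rewrite Re_Cconj_mult_self. apply Rmult_lt_0_compat.
  - apply Re_inv_pos, g_pos, half_plane_convex; auto.
  - apply pow_lt, Cmod_gt_0. intros E0; apply Hne.
    replace w with ((w - z) + z)%C by ring. rewrite E0; ring.
Qed.

Lemma primitive_injective (z w : C) : half_plane z -> half_plane w -> H z = H w -> z = w.
Proof.
  intros Hz Hw E; apply NNPP; intros Hne.
  pose proof (primitive_Re_increment_pos z w Hz Hw Hne) as P.
  rewrite E in P. replace (H w - H w)%C with (RtoC 0) in P by ring.
  rewrite Cmult_0_r in P; simpl in P; lra.
Qed.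

(** The solution of [H w = p] is the fixed point of the Newton map with the
    derivative frozen at [z], which contracts by 1/2 near [z] because [H'] is
    continuous. *)
Lemma primitive_open (z : C) : half_plane z -> exists delta, 0 < delta /\
  forall p, Cmod (p - H z) < delta -> exists w, half_plane w /\ H w = p.
Proof.
  intros Hz.
  pose proof (neq_0_of_Re_pos _ (g_pos z Hz)) as Hg0.
  assert (Hm : 0 < Cmod (g z)) by (apply Cmod_gt_0, Hg0).
  destruct (reciprocal_continuous z Hz (1 / 2 / Cmod (g z))) as [r [Hr Hc]];
    [apply Rdiv_lt_0_compat; lra |].
  exists (r / 8 / Cmod (g z)); split; [apply Rdiv_lt_0_compat; lra |].
  intros p Hp.
  set (T := fun w => (w + -(1) * (g z * (H w + - p)))%C).
  assert (DT : forall u, half_plane u -> cderiv T u (1 + -(1) * (g z * (/ g u + 0)))).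
  { intros u Hu. apply deriv_along_plus; [apply deriv_along_id |].
    apply deriv_along_scal, deriv_along_scal, deriv_along_plus;
      [apply H_deriv, Hu | apply deriv_along_const]. }
  assert (Hb : forall u, Cmod (u - z) <= r / 2 -> half_plane u)
    by (intros u Hu; apply Hc; lra).
  destruct (half_contraction_fixed_point T z (r / 2)) as [w [Hw1 Hw2]]; [lra | | |].
  - intros u v Hu Hv.
    apply (mean_value_bound T _ v u (1 / 2) DT); auto.
    intros t Ht. set (x := (v + RtoC t * (u - v))%C).
    assert (Hx : Cmod (x - z) <= r / 2).
    { replace (x - z)%C with (RtoC (1 - t) * (v - z) + RtoC t * (u - z))%C
        by (unfold x; rewrite RtoC_minus; ring).
      eapply Rle_trans; [apply Cmod_triangle |].
      rewrite !Cmod_mult, !Cmod_R, !Rabs_pos_eq by lra. nra. }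
    destruct (Hc x ltac:(lra)) as [Hxp Hxc].
    replace (1 + -(1) * (g z * (/ g x + 0)))%C with (- (g z * (/ g x - / g z)))%C
      by (field; split; [apply (neq_0_of_Re_pos _ (g_pos x Hxp)) | exact Hg0]).
    rewrite Cmod_opp, Cmod_mult.
    apply Rlt_le, Rlt_le_trans with (Cmod (g z) * (1 / 2 / Cmod (g z))).
    + apply Rmult_lt_compat_l; auto.
    + right; field; lra.
  (* The image of the centre is within a quarter of the radius r / 2. *)
  - unfold T. replace (z + -(1) * (g z * (H z + - p)) - z)%C with (g z * (p - H z))%C by ring.
    rewrite Cmod_mult.
    apply Rle_trans with (Cmod (g z) * (r / 8 / Cmod (g z))).
    + apply Rmult_le_compat_l; lra.
    + right; field; lra.
  - exists w; split; [apply Hb, Hw1 |].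
    unfold T in Hw2.
    assert (E : (g z * (H w - p))%C = 0).
    { replace (g z * (H w - p))%C with (w - (w + -(1) * (g z * (H w + - p))))%C by ring.
      rewrite Hw2; ring. }
    assert (E2 : (H w - p)%C = 0).
    { replace (H w - p)%C with (/ g z * (g z * (H w - p)))%C by (field; exact Hg0).
      rewrite E; ring. }
    replace (H w) with ((H w - p) + p)%C by ring. rewrite E2; ring.
Qed.

(** If [w] is at distance at least [eps] from [z], let [v] be the point of
    the segment from [z] to [w] at distance [rho]. The increment of [H] in the
    direction [w - z] is at least [rho Re H' z / 2] from [z] to [v], and it is
    nonnegative from [v] to [w]. *)
Lemma primitive_inverse_continuous (z : C) : half_plane z -> forall eps, 0 < eps ->
  exists delta, 0 < delta /\ forall w, half_plane w ->
    Cmod (H w - H z) < delta -> Cmod (w - z) < eps.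
Proof.
  intros Hz eps He.
  pose proof (Re_inv_pos _ (g_pos z Hz)) as Hp.
  destruct (reciprocal_continuous z Hz (Re (/ g z) / 2)) as [r [Hr Hc]]; [lra |].
  set (rho := Rmin r eps / 2).
  assert (Hrho : 0 < rho) by (unfold rho; pose proof (Rmin_pos r eps Hr He); lra).
  assert (Hrho1 : rho < r) by (unfold rho in *; pose proof (Rmin_l r eps); lra).
  assert (Hrho2 : rho < eps) by (unfold rho in *; pose proof (Rmin_r r eps); lra).
  exists (Re (/ g z) / 2 * rho); split; [apply Rmult_lt_0_compat; lra |].
  intros w Hw Hlt; apply Rnot_le_lt; intros Hfar.
  set (D := Cmod (w - z)) in *.
  set (s := rho / D).
  assert (Hs : 0 < s < 1).
  { split; [apply Rdiv_lt_0_compat; lra | apply Rlt_div_l; lra]. }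
  set (v := (z + RtoC s * (w - z))%C).
  assert (Hv : half_plane v) by (apply half_plane_convex; auto; lra).
  assert (Evw : (w - v)%C = (RtoC (1 - s) * (w - z))%C)
    by (unfold v; rewrite RtoC_minus; ring).
  assert (P1 : 0 <= Re (Cconj (w - z) * (H w - H v))).
  { destruct (mean_value_segment H (fun u => / g u)%C (Cconj (w - z)) v w H_deriv Hv Hw)
      as [t [Ht E]].
    rewrite E, Evw. set (u := (v + _)%C).
    assert (Hu : half_plane u).
    { unfold u; rewrite <- Evw; apply half_plane_convex; auto. }
    replace (Re _) with ((1 - s) * (Re (/ g u) * Re (Cconj (w - z) * (w - z))))
      by (unfold Re; simpl; ring).
    rewrite Re_Cconj_mult_self.
    apply Rmult_le_pos; [lra |]. apply Rmult_le_pos; [| apply pow2_ge_0].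
    apply Rlt_le, Re_inv_pos, g_pos, Hu. }
  assert (P2 : Re (/ g z) / 2 * rho * D <= Re (Cconj (w - z) * (H v - H z))).
  { destruct (mean_value_segment H (fun u => / g u)%C (Cconj (w - z)) z v H_deriv Hz Hv)
      as [t [Ht E]].
    rewrite E. set (u := (z + RtoC t * (v - z))%C).
    assert (Evz : (v - z)%C = (RtoC s * (w - z))%C) by (unfold v; ring).
    assert (Hu : Cmod (u - z) < r).
    { replace (u - z)%C with (RtoC t * (RtoC s * (w - z)))%C
        by (unfold u; rewrite Evz; ring).
      rewrite !Cmod_mult, !Cmod_R, !Rabs_pos_eq by lra. fold D.
      replace (s * D) with rho by (unfold s; field; lra). nra. }
    destruct (Hc u Hu) as [_ Hu2].
    pose proof (re_le_Cmod (/ g u - / g z)) as B.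
    change (Re (/ g u - / g z)) with (Re (/ g u) - Re (/ g z)) in B.
    apply Rabs_le_between in B.
    rewrite Evz.
    replace (Re (Cconj (w - z) * (/ g u * (RtoC s * (w - z))))) with (s * (Re (/ g u) * Re (Cconj (w - z) * (w - z))))
      by (unfold Re; simpl; ring).
    rewrite Re_Cconj_mult_self. fold D.
    replace (s * (Re (/ g u) * D ^ 2)) with (Re (/ g u) * (rho * D)) by (unfold s; field; lra).
    rewrite Rmult_assoc. apply Rmult_le_compat_r; [nra | lra]. }
  assert (P3 : Re (Cconj (w - z) * (H w - H z)) <= D * Cmod (H w - H z)).
  { eapply Rle_trans; [apply Rle_abs |]. eapply Rle_trans; [apply re_le_Cmod |].
    rewrite Cmod_mult, Cmod_Cconj; apply Rle_refl. }
  replace (Re (Cconj (w - z) * (H w - H z))) with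
    (Re (Cconj (w - z) * (H w - H v)) + Re (Cconj (w - z) * (H v - H z))) in P3
    by (unfold Re; simpl; ring).
  nra.
Qed.

Definition inverse_branch (p : C) : C :=
  epsilon (inhabits (RtoC 0)) (fun w => half_plane w /\ H w = p).

Lemma inverse_branch_spec (p : C) : (exists w, half_plane w /\ H w = p) ->
  half_plane (inverse_branch p) /\ H (inverse_branch p) = p.
Proof. intros E; exact (epsilon_spec (inhabits (RtoC 0)) _ E). Qed.

Lemma inverse_branch_primitive (z : C) : half_plane z -> inverse_branch (H z) = z.
Proof.
  intros Hz; destruct (inverse_branch_spec (H z)) as [P E]; [exists z; auto |].
  apply primitive_injective; auto.
Qed.

Lemma cderiv_inverse_branch (z : C) : half_plane z -> cderiv inverse_branch (H z) (g z).
Proof.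
  intros Hz eps He.
  pose proof (neq_0_of_Re_pos _ (g_pos z Hz)) as Hg0.
  assert (Hm : 0 < Cmod (g z)) by (apply Cmod_gt_0, Hg0).
  set (m := Cmod (g z)) in *.
  (* The first bound gives |w - z| <= 2 m |p - H z|, the second the error. *)
  set (eta := Rmin (1 / (2 * m)) (eps / (2 * m ^ 2))).
  assert (Heta : 0 < eta).
  { apply Rmin_pos; apply Rdiv_lt_0_compat; try lra.
    pose proof (pow_lt m 2 Hm); lra. }
  assert (E1 : m * eta <= 1 / 2).
  { replace (1 / 2) with (m * (1 / (2 * m))) by (field; lra).
    apply Rmult_le_compat_l; [lra | apply Rmin_l]. }
  assert (E2 : 2 * m ^ 2 * eta <= eps).
  { apply Rle_trans with (2 * m ^ 2 * (eps / (2 * m ^ 2))); [| right; field; lra].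
    apply Rmult_le_compat_l; [pose proof (pow_lt m 2 Hm); lra | apply Rmin_r]. }
  destruct (H_deriv z Hz eta Heta) as [d1 [Hd1 HD]].
  destruct (primitive_inverse_continuous z Hz d1 Hd1) as [d2 [Hd2 HC]].
  destruct (primitive_open z Hz) as [d3 [Hd3 HO]].
  exists (Rmin d2 d3); split; [apply Rmin_pos; auto |].
  intros p Hp; rewrite inverse_branch_primitive by exact Hz.
  destruct (inverse_branch_spec p) as [Pw Ew].
  { apply HO, (Rlt_le_trans _ _ _ Hp (Rmin_r _ _)). }
  set (w := inverse_branch p) in *.
  assert (Hwz : Cmod (w - z) < d1).
  { apply HC; auto. rewrite Ew; apply (Rlt_le_trans _ _ _ Hp (Rmin_l _ _)). }
  specialize (HD w Hwz). rewrite Ew in HD.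
  assert (Key : Cmod (w - z - g z * (p - H z)) <= m * eta * Cmod (w - z)).
  { replace (w - z - g z * (p - H z))%C with (- (g z * (p - H z - / g z * (w - z))))%C
      by (field; exact Hg0).
    rewrite Cmod_opp, Cmod_mult; fold m.
    rewrite Rmult_assoc; apply Rmult_le_compat_l; [lra | exact HD]. }
  pose proof (Cmod_ge_0 (w - z)) as W0; pose proof (Cmod_ge_0 (p - H z)).
  assert (Lip : Cmod (w - z) <= 2 * m * Cmod (p - H z)).
  { assert (T : Cmod (w - z) <= Cmod (w - z - g z * (p - H z)) + m * Cmod (p - H z)).
    { replace (w - z)%C with ((w - z - g z * (p - H z)) + g z * (p - H z))%C at 1 by ring.
      eapply Rle_trans; [apply Cmod_triangle |]. rewrite Cmod_mult; apply Rle_refl. }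
    nra. }
  apply Rle_trans with (m * eta * (2 * m * Cmod (p - H z))).
  { apply (Rle_trans _ _ _ Key), Rmult_le_compat_l; [apply Rmult_le_pos; lra | exact Lip]. }
  replace (m * eta * (2 * m * Cmod (p - H z))) with (2 * m ^ 2 * eta * Cmod (p - H z)) by ring.
  apply Rmult_le_compat_r; auto.
Qed.

End Inverse.

(** * Flows of generators with positive real part *)

Lemma real_induction (P : R -> Prop) :
  (forall s, 0 <= s -> (forall r, 0 <= r < s -> P r) -> P s) ->
  (forall s, 0 <= s -> P s -> (forall r, 0 <= r < s -> P r) ->
     exists delta, 0 < delta /\ forall r, s < r < s + delta -> P r) ->
  forall s, 0 <= s -> P s.
Proof.
  intros Hclosed Hopen s1 Hs1; apply NNPP; intros Hn.
  set (E := fun s => 0 <= s /\ forall r, 0 <= r < s -> P r).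
  destruct (completeness E) as [s [Hub Hleast]].
  - exists s1; intros s [Hs0 Hs]. apply Rnot_lt_le; intros Hlt. apply Hn, Hs; lra.
  - exists 0; split; [lra | intros; lra].
  - assert (Hs0 : 0 <= s) by (apply Hub; split; [lra | intros; lra]).
    assert (Hbelow : forall r, 0 <= r < s -> P r).
    { intros r Hr; apply NNPP; intros HP.
      assert (s <= r); [| lra].
      apply Hleast; intros q [Hq0 Hq]. apply Rnot_lt_le; intros Hlt. apply HP, Hq; lra. }
    pose proof (Hclosed s Hs0 Hbelow) as Ps.
    destruct (Hopen s Hs0 Ps Hbelow) as [dl [Hd Hab]].
    assert (s + dl <= s); [| lra].
    apply Hub; split; [lra |]. intros r Hr.
    destruct (Rtotal_order r s) as [Hl | [-> | Hl]]; [apply Hbelow; lra | exact Ps |].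
    apply Hab; lra.
Qed.

Lemma is_derive_ratio_sq (a b x : R -> R) (s da db dx : R) :
  is_derive a s da -> is_derive b s db -> is_derive x s dx -> 0 < x s ->
  is_derive (fun s => (a s ^ 2 + b s ^ 2) / x s ^ 2) s
    (2 / x s ^ 3 * (x s * (a s * da + b s * db) - (a s ^ 2 + b s ^ 2) * dx)).
Proof.
  intros Ha Hb Hx Hp.
  auto_derive.
  - repeat split; try (eexists; eassumption). nra.
  - rewrite (is_derive_unique (fun t : R => a t) s da Ha),
      (is_derive_unique (fun t : R => b t) s db Hb),
      (is_derive_unique (fun t : R => x t) s dx Hx).
    field; lra.
Qed.

Section Flow.
Context (g H : C -> C).
Hypothesis g_hol : holomorphic g.
Hypothesis g_pos : forall z, half_plane z -> 0 < Re (g z).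
Hypothesis H_deriv : forall z, half_plane z -> cderiv H z (/ g z).

(** The derivative of [(|g W| / Re W) ^ 2] has the sign of
    [Re W Re (g' W) - Re (g W)], nonpositive by Schwarz-Pick. So the velocity
    [g W] is at most proportional to [Re W], and [Re W] grows at most
    exponentially. *)
Lemma no_blow_up (W : R -> C) (s1 : R) :
  0 <= s1 -> (forall s, 0 <= s <= s1 -> half_plane (W s)) ->
  (forall s, 0 <= s <= s1 -> rderiv W s (g (W s))) ->
  Re (W 0) <= Re (W s1) /\
  Cmod (g (W s1)) <=
    Cmod (g (W 0)) * exp (Cmod (g (W 0)) / Re (W 0) * s1).
Proof.
  intros Hs1 HW DW.
  destruct (holomorphic_has_derivative g g_hol) as [dg Hdg].
  assert (Dx : forall s, 0 <= s <= s1 -> is_derive (fun s => Re (W s)) s (Re (g (W s)))).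
  { intros s Hs. pose proof (rderiv_is_derive _ _ _ 1 (DW s Hs)) as D.
    rewrite Cmult_1_l in D.
    apply (is_derive_ext (fun s => Re (1 * W s))); [| exact D].
    intros t; rewrite Cmult_1_l; reflexivity. }
  assert (Dq : forall s, 0 <= s <= s1 -> rderiv (fun s => g (W s)) s (dg (W s) * g (W s))).
  { intros s Hs; apply (deriv_along_comp RtoC W g); [apply DW, Hs | apply Hdg, HW, Hs]. }
  assert (Da : forall s, 0 <= s <= s1 ->
    is_derive (fun s => Re (g (W s))) s (Re (dg (W s) * g (W s)))).
  { intros s Hs. pose proof (rderiv_is_derive _ _ _ 1 (Dq s Hs)) as D.
    rewrite Cmult_1_l in D.
    apply (is_derive_ext (fun s => Re (1 * g (W s)))); [| exact D].
    intros t; rewrite Cmult_1_l; reflexivity. }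
  assert (Db : forall s, 0 <= s <= s1 ->
    is_derive (fun s => Im (g (W s))) s (Im (dg (W s) * g (W s)))).
  { intros s Hs. pose proof (rderiv_is_derive _ _ _ (- Ci)%C (Dq s Hs)) as D.
    replace (Im (dg (W s) * g (W s))) with (Re (- Ci * (dg (W s) * g (W s))))
      by (unfold Re, Im; simpl; ring).
    apply (is_derive_ext (fun s => Re (- Ci * g (W s)))); [| exact D].
    intros t; unfold Re, Im; simpl; ring. }
  assert (Hx : Re (W 0) <= Re (W s1)).
  { pose proof (gronwall (fun s => - Re (W s)) (fun s => - Re (g (W s))) 0 s1 Hs1) as B.
    rewrite Rmult_0_l, exp_0, Rmult_1_r in B.
    cut (- Re (W s1) <= - Re (W 0)); [lra |]. apply B; intros s Hs.
    - apply (is_derive_opp (fun s => Re (W s))), Dx, Hs.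
    - rewrite Rmult_0_l. pose proof (g_pos _ (HW s Hs)); lra. }
  split; [exact Hx |].
  set (n := Cmod (g (W 0)) / Re (W 0)).
  assert (Hx0 : 0 < Re (W 0)) by (apply HW; lra).
  assert (Hn : 0 <= n) by (apply Rle_div_r; [lra |]; rewrite Rmult_0_l; apply Cmod_ge_0).
  (* Along a trajectory the hyperbolic speed does not increase. *)
  assert (Hspeed : forall s, 0 <= s <= s1 -> Cmod (g (W s)) <= n * Re (W s)).
  { intros s Hs.
    pose proof (gronwall (fun s => (Re (g (W s)) ^ 2 + Im (g (W s)) ^ 2) / Re (W s) ^ 2)
      (fun s => 2 / Re (W s) ^ 3 * (Re (W s) *
        (Re (g (W s)) * Re (dg (W s) * g (W s)) + Im (g (W s)) * Im (dg (W s) * g (W s)))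
        - (Re (g (W s)) ^ 2 + Im (g (W s)) ^ 2) * Re (g (W s)))) 0 s) as B.
    rewrite Rmult_0_l, exp_0, Rmult_1_r in B.
    assert (Hxs : 0 < Re (W s)) by (apply HW; lra).
    assert (N : Cmod (g (W s)) ^ 2 / Re (W s) ^ 2 <= Cmod (g (W 0)) ^ 2 / Re (W 0) ^ 2).
    { rewrite !Cmod_sq. apply B; [lra | |]; intros t Ht.
      - assert (Ht' : 0 <= t <= s1) by lra.
        apply is_derive_ratio_sq; auto. apply HW, Ht'.
      - rewrite Rmult_0_l. assert (Ht' : 0 <= t <= s1) by lra.
        pose proof (HW t Ht') as Hp.
        pose proof (schwarz_pick g (W t) (dg (W t)) g_hol
          (fun u Hu => Rlt_le _ _ (g_pos u Hu)) Hp (Hdg _ Hp)) as SP.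
        unfold half_plane in Hp.
        pose proof (Rle_trans _ _ _ (Rle_abs _) (re_le_Cmod (dg (W t)))) as RC.
        set (x := Re (W t)) in *. set (q := g (W t)) in *. set (d := dg (W t)) in *.
        replace (Re q * Re (d * q) + Im q * Im (d * q)) with ((Re q ^ 2 + Im q ^ 2) * Re d)
          by (unfold Re, Im; simpl; ring).
        assert (0 <= Re q ^ 2 + Im q ^ 2)
          by (apply Rplus_le_le_0_compat; apply pow2_ge_0).
        assert (x * Re d <= Re q) by nra.
        assert (0 < 2 / x ^ 3) by (apply Rdiv_lt_0_compat; [lra | apply pow_lt, Hp]).
        replace (x * ((Re q ^ 2 + Im q ^ 2) * Re d) - (Re q ^ 2 + Im q ^ 2) * Re q)
          with (- ((Re q ^ 2 + Im q ^ 2) * (Re q - x * Re d))) by ring.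
        assert (0 <= (Re q ^ 2 + Im q ^ 2) * (Re q - x * Re d))
          by (apply Rmult_le_pos; lra).
        nra. }
    apply Rle_div_l; [exact Hxs |].
    apply Rsqr_incr_0_var; [| exact Hn].
    unfold n; rewrite !Rsqr_pow2. unfold Rdiv; rewrite !Rpow_mult_distr, !pow_inv. exact N. }
  assert (Hgrow : Re (W s1) <= Re (W 0) * exp (n * s1)).
  { apply (gronwall (fun s => Re (W s)) (fun s => Re (g (W s)))); auto.
    intros s Hs. eapply Rle_trans; [apply Rle_abs |].
    eapply Rle_trans; [apply re_le_Cmod |]. apply Hspeed, Hs. }
  eapply Rle_trans; [apply Hspeed; lra |].
  replace (Cmod (g (W 0))) with (n * Re (W 0)) by (unfold n; field; lra).
  rewrite Rmult_assoc; apply Rmult_le_compat_l; assumption.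
Qed.

(** The set of reached times is open because [H] is an open map. It is
    closed because the trajectory, of bounded velocity by [no_blow_up], has a
    limit, which lies in the half-plane since [Re] increases. *)
Lemma flow_exists (z : C) : half_plane z ->
  forall s, 0 <= s -> exists w, half_plane w /\ H w = (H z + RtoC s)%C.
Proof.
  intros Hz. apply real_induction.
  - intros s Hs HP.
    destruct (Rle_lt_or_eq_dec 0 s Hs) as [Hpos | <-].
    2:{ exists z; split; [exact Hz | ring]. }
    set (W := fun s => inverse_branch H (H z + RtoC s)%C).
    assert (HW : forall t, 0 <= t < s -> half_plane (W t) /\ H (W t) = (H z + RtoC t)%C)
      by (intros t Ht; apply inverse_branch_spec, HP, Ht).
    assert (DW : forall t, 0 <= t < s -> rderiv W t (g (W t))).
    { intros t Ht; destruct (HW t Ht) as [H1 H2].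
      replace (g (W t)) with (g (W t) * 1)%C by ring.
      apply (deriv_along_comp RtoC (fun s => H z + RtoC s)%C (inverse_branch H)).
      - apply (deriv_along_ext _ (fun s => H z + RtoC s * 1)%C); [intros; ring |].
        apply rderiv_line.
      - rewrite <- H2. apply cderiv_inverse_branch; auto. }
    assert (W0 : W 0 = z).
    { unfold W. rewrite Cplus_0_r. apply (inverse_branch_primitive g); auto. }
    set (L := Cmod (g z) * exp (Cmod (g z) / Re z * s)).
    assert (Bd : forall t, 0 <= t < s -> Re z <= Re (W t) /\ Cmod (g (W t)) <= L).
    { intros t Ht. destruct (no_blow_up W t) as [B1 B2]; [lra | | |].
      - intros r Hr; apply HW; lra.
      - intros r Hr; apply DW; lra.
      - rewrite W0 in B1, B2; split; [exact B1 |].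
        apply (Rle_trans _ _ _ B2). unfold L.
        apply Rmult_le_compat_l; [apply Cmod_ge_0 |].
        assert (Hq : 0 <= Cmod (g z) / Re z)
          by (apply Rle_div_r; [exact Hz |]; rewrite Rmult_0_l; apply Cmod_ge_0).
        assert (Hle : Cmod (g z) / Re z * t <= Cmod (g z) / Re z * s)
          by (apply Rmult_le_compat_l; lra).
        destruct Hle as [Hle | ->]; [left; apply exp_increasing, Hle | lra]. }
    assert (HL : 0 <= L).
    { unfold L; apply Rmult_le_pos; [apply Cmod_ge_0 | left; apply exp_pos]. }
    assert (Lip : forall t r, 0 <= t <= r -> r < s -> Cmod (W r - W t) <= L * (r - t)).
    { intros t r Ht Hr. apply (mean_value_curve_bound W (fun r => g (W r))); [lra | |].
      - intros q Hq; apply DW; lra.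
      - intros q Hq; apply Bd; lra. }
    destruct (discs_meet (I := {t : R | 0 <= t < s})
      (exist _ 0 (conj (Rle_refl 0) Hpos))
      (fun t => W (proj1_sig t)) (fun t => L * (s - proj1_sig t))) as [l Hl].
    { intros [t Ht] [r Hr]; simpl.
      destruct (Rle_dec t r) as [Hc | Hc].
      - rewrite Cmod_sub_comm. pose proof (Lip t r ltac:(lra) ltac:(lra)). nra.
      - pose proof (Lip r t ltac:(lra) ltac:(lra)). nra. }
    assert (Hl' : forall t, 0 <= t < s -> Cmod (l - W t) <= 2 * (L * (s - t)))
      by (intros t Ht; exact (Hl (exist _ t Ht))).
    assert (Hclose : forall eta, 0 < eta -> exists t, 0 <= t < s /\ s - t < eta /\
      Cmod (W t - l) < eta).
    { intros eta He.
      assert (Hq : 0 < eta / (2 * L + 2)) by (apply Rdiv_lt_0_compat; lra).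
      assert (Hq2 : eta / (2 * L + 2) * (2 * L + 2) = eta) by (field; lra).
      set (q := eta / (2 * L + 2)) in *.
      exists (Rmax 0 (s - q)).
      pose proof (Rmax_l 0 (s - q)); pose proof (Rmax_r 0 (s - q)).
      assert (Hlt : Rmax 0 (s - q) < s) by (apply Rmax_lub_lt; lra).
      specialize (Hl' (Rmax 0 (s - q)) ltac:(lra)).
      rewrite Cmod_sub_comm in Hl'.
      split; [lra |]; split; nra. }
    assert (Hlp : half_plane l).
    { unfold half_plane in *.
      destruct (Hclose (Re z) Hz) as [t [Ht [_ Hc]]].
      destruct (Bd t Ht) as [B1 _].
      pose proof (re_le_Cmod (W t - l)) as A.
      change (Re (W t - l)) with (Re (W t) - Re l) in A. apply Rabs_le_between in A. lra. }
    exists l; split; [exact Hlp |].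
    assert (Zr : Cmod (H l - (H z + RtoC s)) <= 0).
    { apply le_epsilon; intros eps He; rewrite Rplus_0_l.
      destruct (deriv_along_continuous _ _ _ _ (H_deriv l Hlp) (eps / 2)) as [dl [Hd Hc]]; [lra |].
      destruct (Hclose (Rmin dl (eps / 2))) as [t [Ht [H1 H2]]]; [apply Rmin_pos; lra |].
      specialize (Hc (W t) (Rlt_le_trans _ _ _ H2 (Rmin_l _ _))).
      rewrite (proj2 (HW t Ht)) in Hc.
      pose proof (Cmod_triangle_sub (H l) (H z + RtoC t) (H z + RtoC s)) as T.
      rewrite (Cmod_sub_comm (H l) (H z + RtoC t)) in T.
      replace (H z + RtoC t - (H z + RtoC s))%C with (RtoC (t - s)) in T
        by (rewrite RtoC_minus; ring).
      rewrite (Cmod_R (t - s)), Rabs_left in T by lra.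
      pose proof (Rmin_r dl (eps / 2)). lra. }
    assert (Z0 : (H l - (H z + RtoC s))%C = 0)
      by (apply Cmod_eq_0, Rle_antisym; [exact Zr | apply Cmod_ge_0]).
    replace (H l) with ((H l - (H z + RtoC s)) + (H z + RtoC s))%C by ring.
    rewrite Z0; ring.
  - intros s Hs [w [Hw Ew]] _.
    destruct (primitive_open g H g_hol g_pos H_deriv w Hw) as [dl [Hd HO]].
    exists dl; split; [exact Hd |]; intros r Hr. apply HO. rewrite Ew.
    replace (H z + RtoC r - (H z + RtoC s))%C with (RtoC (r - s))
      by (rewrite RtoC_minus; ring).
    rewrite Cmod_R, Rabs_pos_eq; lra.
Qed.

End Flow.

(** * One-parameter semigroups *)

Lemma filterlim_at_right_eps (phi : R -> C) (l : C) :
  filterlim phi (at_right 0) (locally l) -> forall eps, 0 < eps ->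
  exists delta, 0 < delta /\ forall t, 0 < t < delta -> Cmod (phi t - l) < eps.
Proof.
  intros H eps He.
  assert (He2 : 0 < eps / 2) by lra.
  destruct (proj1 (filterlim_locally phi l) H (mkposreal _ He2)) as [dl Hd].
  exists dl; split; [apply cond_pos |].
  intros t Ht.
  destruct (Hd t) as [B1 B2]; [| lra |].
  { change (Rabs (t - 0) < dl). rewrite Rminus_0_r, Rabs_pos_eq; lra. }
  change (Rabs (Re (phi t) - Re l) < eps / 2) in B1.
  change (Rabs (Im (phi t) - Im l) < eps / 2) in B2.
  eapply Rle_lt_trans; [apply Cmod_re_im |].
  change (Re (phi t - l)) with (Re (phi t) - Re l).
  change (Im (phi t - l)) with (Im (phi t) - Im l). lra.
Qed.

Lemma semigroup_holomorphic (F : R -> C -> C) (t : R) :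
  is_semigroup F -> 0 <= t -> holomorphic (F t).
Proof.
  intros [Hhol _] Ht z Hz. apply differentiable_iff_ex_derive, Hhol; assumption.
Qed.

Lemma semigroup_at_0 (F : R -> C -> C) (z : C) :
  is_semigroup F -> half_plane z -> F 0 z = z.
Proof.
  intros [Hhol [Hadd Hlim]] Hz.
  assert (H0 : half_plane (F 0 z)) by (apply Hhol; [lra | exact Hz]).
  apply eq_of_Cmod_sub_le; intros eps He.
  destruct (filterlim_at_right_eps _ _ (Hlim z Hz) (eps / 2)) as [d1 [Hd1 H1]]; [lra |].
  destruct (filterlim_at_right_eps _ _ (Hlim _ H0) (eps / 2)) as [d2 [Hd2 H2]]; [lra |].
  assert (Hm : 0 < Rmin d1 d2) by (apply Rmin_pos; lra).
  pose proof (Rmin_l d1 d2); pose proof (Rmin_r d1 d2).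
  specialize (H1 (Rmin d1 d2 / 2) ltac:(lra)); specialize (H2 (Rmin d1 d2 / 2) ltac:(lra)).
  rewrite Hadd, Rplus_0_r in H2 by (auto; lra).
  pose proof (Cmod_triangle_sub (F 0 z) (F (Rmin d1 d2 / 2) z) z) as T.
  rewrite (Cmod_sub_comm (F 0 z) (F (Rmin d1 d2 / 2) z)) in T. lra.
Qed.

(** [F_t z = F_s (F_(t-s) z)], so the claim compares the values of [F_s] at
    [z] and at the nearby point [F_(t-s) z], uniformly in [s]. *)
Lemma semigroup_left_continuous (F : R -> C -> C) (z : C) (t : R) :
  is_semigroup F -> half_plane z -> forall eps, 0 < eps ->
  exists delta, 0 < delta /\ forall s, 0 <= s -> t - delta < s < t ->
    Cmod (F s z - F t z) < eps.
Proof.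
  intros HF Hz eps He.
  pose proof HF as [Hhol [Hadd Hlim]].
  set (m := Re z / 2).
  assert (Hm : 0 < m) by (unfold m; unfold half_plane in Hz; lra).
  set (K := Rabs (Re (F t z)) * exp 1 / m).
  assert (HK : 0 <= K).
  { unfold K; apply Rle_div_r; [exact Hm |]. rewrite Rmult_0_l.
    apply Rmult_le_pos; [apply Rabs_pos | left; apply exp_pos]. }
  assert (Hq : 0 < eps / (K + 1)) by (apply Rdiv_lt_0_compat; lra).
  destruct (filterlim_at_right_eps _ _ (Hlim z Hz) (Rmin m (eps / (K + 1))))
    as [dl [Hd HL]]; [apply Rmin_pos; lra |].
  exists dl; split; [exact Hd |]. intros s Hs Hst.
  specialize (HL (t - s) ltac:(lra)).
  set (v := F (t - s) z) in *.
  pose proof (Rlt_le_trans _ _ _ HL (Rmin_l _ _)) as L1.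
  pose proof (Rlt_le_trans _ _ _ HL (Rmin_r _ _)) as L2.
  assert (Et : F t z = F s v).
  { unfold v; rewrite Hadd by (auto; lra). f_equal; ring. }
  assert (Hv : m <= Re v).
  { pose proof (re_le_Cmod (v - z)) as A. change (Re (v - z)) with (Re v - Re z) in A.
    apply Rabs_le_between in A. unfold m in *; lra. }
  rewrite (Cmod_sub_comm v z) in L1, L2.
  pose proof (lipschitz_segment (F s) v z m (semigroup_holomorphic F s HF Hs)
    (fun u Hu => Rlt_le _ _ (proj1 (Hhol s Hs) u Hu)) Hm Hv ltac:(unfold m in *; lra)) as B.
  rewrite <- Et in B.
  apply (Rle_lt_trans _ _ _ B).
  apply Rle_lt_trans with (K * Cmod (z - v)).
  - apply Rmult_le_compat_r; [apply Cmod_ge_0 |].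
    unfold K; apply Rmult_le_compat_r; [left; apply Rinv_0_lt_compat, Hm |].
    assert (X : Cmod (z - v) / m < 1) by (apply Rlt_div_l; lra).
    apply exp_increasing in X.
    apply Rmult_le_compat; [| left; apply exp_pos | apply Rle_abs | lra].
    rewrite Et; left. apply (proj1 (Hhol s Hs)). unfold half_plane; lra.
  - apply Rlt_div_r in L2; [| lra]. pose proof (Cmod_ge_0 (z - v)). nra.
Qed.

(** A function with right derivative 0 everywhere is constant as soon as it
    is also left continuous. The equation is used with [h' = 1 / f], [c = 1],
    and with [h] the identity, [c = 0] when [f = 0]. *)
Lemma abel_equation (F : R -> C -> C) (f h dh : C -> C) (c z : C) :
  is_semigroup F -> is_generator F f ->
  (forall u, half_plane u -> cderiv h u (dh u)) ->
  (forall u, half_plane u -> (dh u * f u)%C = c) ->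
  half_plane z -> forall t, 0 <= t -> h (F t z) = (h z + c * RtoC t)%C.
Proof.
  intros HF Hgen Hh Hc Hz.
  pose proof HF as [Hhol [Hadd Hlim]].
  assert (HFp : forall s u, 0 <= s -> half_plane u -> half_plane (F s u))
    by (intros s u Hs; apply (proj1 (Hhol s Hs))).
  assert (Hright : forall u, half_plane u -> forall eps, 0 < eps ->
    exists delta, 0 < delta /\ forall r, 0 < r < delta ->
      Cmod (h (F r u) - h u - c * RtoC r) <= eps * r).
  { intros u Hu eps He.
    (* F_r u is meaningless for r < 0, so the chain rule is applied with the
       nonnegative reals as domain. *)
    set (j := fun r : {r : R | 0 <= r} => RtoC (proj1_sig r)).
    set (o := exist (fun r => 0 <= r) 0 (Rle_refl 0)).
    assert (D : deriv_along j (fun r => F (proj1_sig r) u) o (f u)).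
    { intros eta Heta.
      destruct (filterlim_at_right_eps _ _ (Hgen u Hu) eta Heta) as [dl [Hd HL]].
      exists dl; split; [exact Hd |]. intros [r Hr]; unfold j, o; simpl.
      rewrite <- RtoC_minus, Cmod_R, Rminus_0_r, (Rabs_pos_eq r Hr).
      rewrite (semigroup_at_0 F u HF Hu). intros Hrd.
      destruct Hr as [Hr | <-].
      - specialize (HL r (conj Hr Hrd)).
        assert (Hr0 : RtoC r <> 0) by (intros E; apply RtoC_inj in E; lra).
        replace (F r u - u - f u * RtoC r)%C
          with (((F r u - u) / RtoC r - f u) * RtoC r)%C by (field; exact Hr0).
        rewrite Cmod_mult, Cmod_R, Rabs_pos_eq by lra.
        apply Rmult_le_compat_r; lra.
      - rewrite (semigroup_at_0 F u HF Hu).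
        replace (u - u - f u * 0)%C with (RtoC 0) by ring. rewrite Cmod_0; lra. }
    assert (D2 : deriv_along j (fun r => h (F (proj1_sig r) u)) o c).
    { rewrite <- (Hc u Hu).
      apply (deriv_along_comp j (fun r => F (proj1_sig r) u) h o); [exact D |].
      simpl; rewrite (semigroup_at_0 F u HF Hu); apply Hh, Hu. }
    destruct (D2 eps He) as [dl [Hd HL]].
    exists dl; split; [exact Hd |]; intros r Hr.
    assert (Hr0 : 0 <= r) by lra.
    specialize (HL (exist _ r Hr0)); unfold j, o in HL; simpl in HL.
    rewrite <- RtoC_minus, Cmod_R, Rminus_0_r, (Rabs_pos_eq r Hr0),
      (semigroup_at_0 F u HF Hu) in HL.
    apply HL; lra. }
  intros t Ht; apply eq_of_Cmod_sub_le; intros eps0 He0.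
  set (eps := eps0 / (t + 1)).
  assert (He : 0 < eps) by (apply Rdiv_lt_0_compat; lra).
  cut (Cmod (h (F t z) - (h z + c * RtoC t)) <= eps * t).
  { intros B; apply (Rle_trans _ _ _ B).
    assert (E0 : eps * (t + 1) = eps0) by (unfold eps; field; lra). nra. }
  generalize t Ht.
  apply (real_induction (fun s => Cmod (h (F s z) - (h z + c * RtoC s)) <= eps * s)).
  - intros s Hs HP.
    destruct (Rle_lt_or_eq_dec 0 s Hs) as [Hpos | <-].
    2:{ rewrite (semigroup_at_0 F z HF Hz).
        replace (h z - (h z + c * 0))%C with (RtoC 0) by ring. rewrite Cmod_0; lra. }
    apply le_epsilon; intros eta Heta.
    destruct (deriv_along_continuous _ _ _ _ (Hh _ (HFp s z Hs Hz)) (eta / 2))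
      as [d1 [Hd1 H1]]; [lra |].
    destruct (semigroup_left_continuous F z s HF Hz d1 Hd1) as [d2 [Hd2 H2]].
    pose proof (Cmod_ge_0 c) as Pc.
    set (d3 := eta / 2 / (Cmod c + 1)).
    assert (Hd3 : 0 < d3) by (apply Rdiv_lt_0_compat; lra).
    set (e := Rmin (Rmin d2 s) d3 / 2).
    assert (Hmin : 0 < Rmin (Rmin d2 s) d3) by (repeat apply Rmin_pos; lra).
    pose proof (Rmin_l (Rmin d2 s) d3); pose proof (Rmin_r (Rmin d2 s) d3).
    pose proof (Rmin_l d2 s); pose proof (Rmin_r d2 s).
    assert (Hr : 0 <= s - e /\ s - d2 < s - e < s) by (unfold e; lra).
    specialize (H1 _ (H2 (s - e) ltac:(lra) ltac:(lra))).
    specialize (HP (s - e) ltac:(lra)).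
    replace (h (F s z) - (h z + c * RtoC s))%C with
      (- (h (F (s - e)%R z) - h (F s z)) + ((h (F (s - e)%R z) - (h z + c * RtoC (s - e)))
        + - (c * RtoC e)))%C by (rewrite RtoC_minus; ring).
    eapply Rle_trans; [apply Cmod_triangle |]. rewrite Cmod_opp.
    eapply Rle_trans; [apply Rplus_le_compat_l, Cmod_triangle |].
    assert (He3 : e < d3) by (unfold e; lra).
    assert (He4 : 0 < e) by (unfold e; lra).
    rewrite Cmod_opp, Cmod_mult, Cmod_R, (Rabs_pos_eq e) by lra.
    apply Rlt_div_r in He3; [| lra].
    assert (eps * (s - e) <= eps * s) by (apply Rmult_le_compat_l; lra).
    lra.
  - intros s Hs HP _.
    destruct (Hright (F s z) (HFp s z Hs Hz) eps He) as [dl [Hd HL]].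
    exists dl; split; [exact Hd |]. intros r Hr.
    specialize (HL (r - s) ltac:(lra)).
    rewrite Hadd in HL by (auto; lra).
    replace (r - s + s) with r in HL by ring.
    replace (h (F r z) - (h z + c * RtoC r))%C with
      ((h (F r z) - h (F s z) - c * RtoC (r - s)) + (h (F s z) - (h z + c * RtoC s)))%C
      by (rewrite RtoC_minus; ring).
    eapply Rle_trans; [apply Cmod_triangle |]. lra.
Qed.

(** * Analytic extension of the shifted semigroup *)

Section Extension.
Context (F : R -> C -> C) (f : C -> C) (k : R).
Hypothesis F_semigroup : is_semigroup F.
Hypothesis F_gen : is_generator F f.
Hypothesis f_hol : holomorphic f.
Hypothesis k_pos : 0 < k.

Lemma half_plane_shift (z : C) : half_plane z -> half_plane (z + RtoC k)%C.
Proof. unfold half_plane; intros Hz; simpl; unfold Re in Hz; lra. Qed.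

Lemma half_plane_unshift (z : C) : half_plane (z - RtoC k)%C <-> k < Re z.
Proof. unfold half_plane; simpl; unfold Re; split; lra. Qed.

Lemma shifted_is_semigroup :
  (forall t z, 0 <= t -> half_plane z -> k < Re (F t (z + RtoC k)%C)) ->
  is_semigroup (shifted F k).
Proof.
  intros Hinv. pose proof F_semigroup as [Hhol [Hadd Hlim]].
  split; [| split].
  - intros t Ht; split.
    + intros z Hz; apply half_plane_unshift, Hinv; auto.
    + intros z Hz; apply differentiable_iff_ex_derive; unfold shifted.
      apply (differentiable_plus (fun z => F t (z + RtoC k)%C));
        [| apply differentiable_const].
      apply (differentiable_comp (fun z => z + RtoC k)%C).
      * apply differentiable_plus; [apply differentiable_id | apply differentiable_const].
      * apply semigroup_holomorphic; auto using half_plane_shift.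
  - intros t s Ht Hs z Hz; unfold shifted.
    replace (F s (z + RtoC k)%C - RtoC k + RtoC k)%C with (F s (z + RtoC k)%C) by ring.
    rewrite Hadd by auto using half_plane_shift; reflexivity.
  - intros z Hz.
    apply filterlim_locally; intros eps.
    pose proof (proj1 (filterlim_locally _ _) (Hlim _ (half_plane_shift z Hz)) eps) as L.
    apply (filter_imp (F := at_right 0)) with (2 := L); intros t [B1 B2].
    unfold shifted; split.
    + change (Rabs (Re (F t (z + RtoC k)%C) - (Re z + k)) < eps) in B1.
      change (Rabs (Re (F t (z + RtoC k)%C) - k - Re z) < eps).
      replace (Re (F t (z + RtoC k)%C) - k - Re z)
        with (Re (F t (z + RtoC k)%C) - (Re z + k)) by ring. exact B1.
    + change (Rabs (Im (F t (z + RtoC k)%C) - (Im z + 0)) < eps) in B2.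
      change (Rabs (Im (F t (z + RtoC k)%C) - 0 - Im z) < eps).
      replace (Im (F t (z + RtoC k)%C) - 0 - Im z)
        with (Im (F t (z + RtoC k)%C) - (Im z + 0)) by ring. exact B2.
Qed.

Lemma extension_of_zero_generator (Omega : C -> Prop) :
  (forall z, half_plane z -> f z = RtoC 0) ->
  is_semigroup (shifted F k) /\ extends_analytically (shifted F k) Omega.
Proof.
  intros Hf.
  assert (HF : forall t z, 0 <= t -> half_plane z -> F t z = z).
  { intros t z Ht Hz.
    rewrite (abel_equation F f (fun w => w) (fun _ => RtoC 1) 0 z); auto.
    - ring.
    - intros u Hu; apply deriv_along_id.
    - intros u Hu; rewrite Hf by exact Hu; ring. }
  split.
  - apply shifted_is_semigroup; intros t z Ht Hz.
    rewrite HF by auto using half_plane_shift.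
    unfold half_plane, Re in *; simpl; lra.
  - exists (fun _ z => z); split; [| split; [| split]].
    + intros zeta _; split; [auto |].
      intros z Hz; apply differentiable_iff_ex_derive, differentiable_id.
    + intros t Ht z Hz; unfold shifted.
      rewrite HF by (auto using half_plane_shift; lra). ring.
    + intros z Hz zeta Hzeta; apply differentiable_iff_ex_derive, differentiable_const.
    + reflexivity.
Qed.

Hypothesis f_pos : forall z, half_plane z -> 0 < Re (f z).

(** This is [flow_exists] at time 1 for the generator [zeta f (u + k)], one of
    whose associated primitives is [h (u + k) / zeta]. *)
Lemma complex_time_reached (h : C -> C) (zeta z : C) :
  (forall u, half_plane u -> cderiv h u (/ f u)) ->
  (forall u, half_plane u -> 0 < Re (zeta * f (u + RtoC k)%C)) -> half_plane z ->
  exists w, k < Re w /\ h w = (h (z + RtoC k)%C + zeta)%C.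
Proof.
  intros Hh Hpos Hz.
  assert (Hzeta : zeta <> 0).
  { intros ->. specialize (Hpos z Hz). rewrite Cmult_0_l in Hpos; simpl in Hpos; lra. }
  assert (Dsh : forall u, cderiv (fun u => u + RtoC k)%C u 1).
  { intros u; apply (cderiv_ext_val _ _ (1 + 0)); [ring |].
    apply deriv_along_plus; [apply deriv_along_id | apply deriv_along_const]. }
  destruct (flow_exists (fun u => zeta * f (u + RtoC k))%C
    (fun u => / zeta * h (u + RtoC k))%C) with (z := z) (s := 1) as [w [Hw Ew]]; auto; try lra.
  - intros u Hu. apply differentiable_mult; [apply differentiable_const |].
    apply (differentiable_comp (fun u => u + RtoC k)%C).
    + exists (RtoC 1); apply Dsh.
    + apply f_hol, half_plane_shift, Hu.
  - intros u Hu.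
    pose proof (neq_0_of_Re_pos _ (f_pos _ (half_plane_shift u Hu))) as Hf0.
    apply (cderiv_ext_val _ _ (/ zeta * (/ f (u + RtoC k)%C * 1))); [field; auto |].
    apply deriv_along_scal.
    apply (deriv_along_comp _ (fun u => u + RtoC k)%C h u); [apply Dsh |].
    apply Hh, half_plane_shift, Hu.
  - exists (w + RtoC k)%C; split.
    + apply half_plane_unshift. replace (w + RtoC k - RtoC k)%C with w by ring. exact Hw.
    + replace (h (w + RtoC k)%C) with (zeta * (/ zeta * h (w + RtoC k)%C))%C
        by (field; exact Hzeta).
      rewrite Ew; field; exact Hzeta.
Qed.

(** [complex_time_reached] applies to real times as well, since [Re f > 0];
    with the injectivity of [h] it shows that the semigroup preserves
    [{Re > k}]. *)
Lemma extension_of_Re_pos (Omega : C -> Prop) :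
  (forall zeta u, Omega zeta -> half_plane u -> 0 < Re (zeta * f (u + RtoC k)%C)) ->
  is_semigroup (shifted F k) /\ extends_analytically (shifted F k) Omega.
Proof.
  intros HOm.
  destruct (primitive_exists (fun z => / f z)%C) as [h Hh].
  { intros z Hz; apply differentiable_inv; [apply f_hol, Hz | apply neq_0_of_Re_pos, f_pos, Hz]. }
  pose proof (proj1 F_semigroup) as Hhol.
  assert (HFp : forall t z, 0 <= t -> half_plane z -> half_plane (F t z))
    by (intros t z Ht; apply (proj1 (Hhol t Ht))).
  assert (Habel : forall t z, 0 <= t -> half_plane z -> h (F t z) = (h z + RtoC t)%C).
  { intros t z Ht Hz. rewrite (abel_equation F f h (fun z => / f z)%C 1 z); auto.
    - ring.
    - intros u Hu; field; apply neq_0_of_Re_pos, f_pos, Hu. }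
  pose proof (primitive_injective f h f_pos Hh) as Hinj.
  pose proof (inverse_branch_primitive f h f_pos Hh) as Hinv.
  pose proof (cderiv_inverse_branch f h f_hol f_pos Hh) as Dinv.
  assert (Hlow : forall w, k < Re w -> half_plane w) by (intros; unfold half_plane; lra).
  assert (Hright : forall t z, 0 <= t -> half_plane z -> k < Re (F t (z + RtoC k)%C)).
  { intros t z Ht Hz. pose proof (half_plane_shift z Hz) as Hzk.
    destruct Ht as [Ht | <-].
    - destruct (complex_time_reached h (RtoC t) z) as [w [Hw Ew]]; auto.
      + intros u Hu. replace (Re _) with (t * Re (f (u + RtoC k)%C))
          by (set (v := f (u + RtoC k)%C); unfold Re; simpl; ring).
        apply Rmult_lt_0_compat; [exact Ht | apply f_pos, half_plane_shift, Hu].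
      + rewrite <- (Hinj w (F t (z + RtoC k)%C)); auto.
        * apply HFp; [lra | exact Hzk].
        * rewrite Ew, Habel by (auto; lra). reflexivity.
    - rewrite semigroup_at_0 by auto. unfold half_plane, Re in *; simpl; lra. }
  split; [apply shifted_is_semigroup, Hright |].
  set (Psi := fun zeta z => (inverse_branch h (h (z + RtoC k)%C + zeta) - RtoC k)%C).
  assert (HPsi : forall zeta z, Omega zeta -> half_plane z -> exists w, k < Re w /\
    h w = (h (z + RtoC k)%C + zeta)%C /\ Psi zeta z = (w - RtoC k)%C).
  { intros zeta z Hzeta Hz.
    destruct (complex_time_reached h zeta z) as [w [Hw Ew]]; auto.
    exists w; split; [exact Hw |]; split; [exact Ew |].
    unfold Psi; rewrite <- Ew, Hinv; auto. }
  exists Psi; split; [| split; [| split]].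
  - intros zeta Hzeta; split; intros z Hz;
      destruct (HPsi zeta z Hzeta Hz) as [w [Hw [Ew EP]]].
    + rewrite EP; apply half_plane_unshift, Hw.
    + apply differentiable_iff_ex_derive.
      apply (differentiable_plus (fun z => inverse_branch h (h (z + RtoC k)%C + zeta)%C));
        [| apply differentiable_const].
      apply (differentiable_comp (fun z => h (z + RtoC k) + zeta)%C).
      * apply differentiable_plus; [| apply differentiable_const].
        apply (differentiable_comp (fun z => z + RtoC k)%C).
        -- apply differentiable_plus; [apply differentiable_id | apply differentiable_const].
        -- eexists; apply Hh, half_plane_shift, Hz.
      * rewrite <- Ew; eexists; apply Dinv; auto.
  - intros t Ht z Hz; unfold Psi, shifted.
    rewrite <- Habel by (auto using half_plane_shift; lra).
    rewrite Hinv by (apply HFp; [lra | apply half_plane_shift, Hz]). reflexivity.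
  - intros z Hz zeta Hzeta; destruct (HPsi zeta z Hzeta Hz) as [w [Hw [Ew EP]]].
    apply differentiable_iff_ex_derive.
    apply (differentiable_plus (fun zeta => inverse_branch h (h (z + RtoC k)%C + zeta)%C));
      [| apply differentiable_const].
    apply (differentiable_comp (fun zeta => h (z + RtoC k) + zeta)%C).
    + apply differentiable_plus; [apply differentiable_const | apply differentiable_id].
    + rewrite <- Ew; eexists; apply Dinv; auto.
  - intros zeta1 zeta2 H1 H2 z Hz.
    destruct (HPsi zeta2 z H2 Hz) as [w [Hw [Ew EP]]].
    rewrite EP; unfold Psi. f_equal; f_equal.
    replace (w - RtoC k + RtoC k)%C with w by ring.
    rewrite Ew; ring.
Qed.

End Extension.

(** * Arguments and sectors *)

Lemma extends_analytically_subset (Phi : R -> C -> C) (O1 O2 : C -> Prop) :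
  (forall z, O1 z -> O2 z) -> extends_analytically Phi O2 -> extends_analytically Phi O1.
Proof.
  intros Hsub [Psi [P1 [P2 [P3 P4]]]]. exists Psi; repeat split; auto.
  - apply P1; auto.
  - apply P1; auto.
  - intros z Hz zeta Hzeta; apply P3; auto.
Qed.

Lemma Re_mult_polar (z w : C) :
  Re (z * w) = Cmod z * Cmod w * cos (Arg z + Arg w).
Proof.
  rewrite (Arg_polar z) at 1; rewrite (Arg_polar w) at 1.
  rewrite cos_plus; unfold Re; simpl; ring.
Qed.

Lemma Re_mult_pos (z w : C) :
  z <> 0 -> w <> 0 -> - (PI / 2) < Arg z + Arg w < PI / 2 -> 0 < Re (z * w).
Proof.
  intros Hz Hw Ha; rewrite Re_mult_polar.
  apply Rmult_lt_0_compat; [apply Rmult_lt_0_compat; apply Cmod_gt_0; assumption |].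
  apply cos_gt_0; lra.
Qed.

Lemma Arg_1 : Arg 1 = 0.
Proof.
  unfold Arg. rewrite Cmod_1.
  destruct (Req_EM_T 1 0); [lra |].
  destruct (Rle_dec 0 (Im 1)) as [_ | Hn]; [| simpl in Hn; lra].
  replace (Re 1 / 1) with 1 by (simpl; field). apply acos_1.
Qed.

Theorem theorem3p2
  (gamma1 gamma2 : R -> R)
  (gamma1_range : forall s : R, 0 <= s -> 0 < gamma1 s < PI / 2)
  (gamma2_range : forall s : R, 0 <= s -> 0 < gamma2 s < PI / 2)
  (gamma1_decr : forall s t : R, 0 <= s -> s <= t -> gamma1 t <= gamma1 s)
  (gamma2_decr : forall s t : R, 0 <= s -> s <= t -> gamma2 t <= gamma2 s)
  (F : R -> C -> C) (f : C -> C)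
  (F_semigroup : is_semigroup F)
  (f_hol : Hol half_plane (fun _ : C => True) f)
  (f_gen : is_generator F f)
  (f_arg : forall z : C, half_plane z ->
     - gamma1 (Re z) <= Arg (f z) <= gamma2 (Re z)) :
  (forall k : R, 0 < k ->
     is_semigroup (shifted F k) /\
     extends_analytically (shifted F k)
       (sector (PI / 2 - gamma1 k) (PI / 2 - gamma2 k))) /\
  (is_lim gamma1 p_infty 0 -> is_lim gamma2 p_infty 0 ->
   forall eps : R, 0 < eps ->
     exists k : R, 0 < k /\
       extends_analytically (shifted F k)
         (sector (PI / 2 - eps) (PI / 2 - eps))).
Proof.
  assert (Hf : holomorphic f)
    by (intros z Hz; apply differentiable_iff_ex_derive, (proj2 f_hol), Hz).
  assert (Hpos : forall z, half_plane z -> f z <> 0 -> 0 < Re (f z)).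
  { intros z Hz H0. rewrite <- (Cmult_1_l (f z)).
    apply Re_mult_pos; [apply C1_nz | exact H0 |]. rewrite Arg_1, Rplus_0_l.
    specialize (f_arg z Hz). unfold half_plane in Hz.
    pose proof (gamma1_range (Re z)); pose proof (gamma2_range (Re z)). lra. }
  assert (Hnn : forall z, half_plane z -> 0 <= Re (f z)).
  { intros z Hz; destruct (classic (f z = RtoC 0)) as [E | E].
    - rewrite E; simpl; lra.
    - apply Rlt_le, Hpos; auto. }
  assert (Main : forall k, 0 < k -> is_semigroup (shifted F k) /\
     extends_analytically (shifted F k)
       (sector (PI / 2 - gamma1 k) (PI / 2 - gamma2 k))).
  { intros k Hk.
    destruct (classic (exists z0, half_plane z0 /\ f z0 = RtoC 0)) as [[z0 [Hz0 E0]] | Hne].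
    - apply (extension_of_zero_generator F f k); auto.
      intros z Hz; apply NNPP; intros Hn.
      pose proof (Re_zero_of_zero f z0 z Hf Hnn Hz0 E0 Hz) as Z.
      specialize (Hpos z Hz Hn); lra.
    - assert (Hn0 : forall z, half_plane z -> f z <> 0)
        by (intros z Hz E; apply Hne; exists z; auto).
      apply (extension_of_Re_pos F f k); auto.
      intros zeta u [Hz0 Hzeta] Hu.
      pose proof (half_plane_shift k Hk u Hu) as Hv.
      apply Re_mult_pos; auto.
      specialize (f_arg _ Hv).
      assert (Hle : k <= Re (u + RtoC k)) by (unfold half_plane, Re in *; simpl; lra).
      pose proof (gamma1_decr k _ (Rlt_le _ _ Hk) Hle).
      pose proof (gamma2_decr k _ (Rlt_le _ _ Hk) Hle). lra. }
  split; [exact Main |].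
  intros L1 L2 eps He.
  apply is_lim_spec in L1; apply is_lim_spec in L2.
  destruct (L1 (mkposreal eps He)) as [M1 H1]; destruct (L2 (mkposreal eps He)) as [M2 H2].
  simpl in H1, H2.
  set (k := Rmax 0 (Rmax M1 M2) + 1).
  assert (B : 0 < k /\ M1 < k /\ M2 < k).
  { unfold k. pose proof (Rmax_l 0 (Rmax M1 M2)); pose proof (Rmax_r 0 (Rmax M1 M2)).
    pose proof (Rmax_l M1 M2); pose proof (Rmax_r M1 M2). lra. }
  exists k; split; [apply B |].
  apply extends_analytically_subset with (2 := proj2 (Main k (proj1 B))).
  intros z [Hz Ha]; split; [exact Hz |].
  specialize (H1 k (proj1 (proj2 B))); specialize (H2 k (proj2 (proj2 B))).
  rewrite Rminus_0_r in H1, H2. apply Rabs_lt_between in H1; apply Rabs_lt_between in H2.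
  lra.
Qed.
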